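(* For every constant number $n=O(1)$ of agents, there is an $\mathsf{NC}$ algorithm that, given an allocation instance with $n$ agents with additive valuations and any ordering $\sigma$ of the agents, outputs the allocation produced by Fixed-Order Round Robin with ordering $\sigma$ (which is an $\mathsf{EF1}$ allocation).
   Context: An allocation instance has a set $M$ of $m$ goods, $n$ agents, and additive valuations $v_i:2^M\to\mathbb{R}_{\ge0}$, $v_i(S)=\sum_{g\in S}v_i(g)$. Each agent has a preference list: an ordering of all goods by nonincreasing value, ties broken arbitrarily but fixed. Fixed-Order Round Robin with ordering $\sigma$: in each round, the agents in the order $\sigma$ each take their highest remaining good according to their preference list, until goods are exhausted (one may assume $m/n$ is an integer by padding with goods valued $0$ by all). An allocation is $\mathsf{EF1}$ if for all agents $i,j$ there is $s\in\mathcal{A}(j)$ with $v_i(\mathcal{A}(i))\ge v_i(\mathcal{A}(j)\setminus\{s\})$. $\mathsf{NC}$: solvable by a deterministic parallel algorithm (binary fork-join work-depth model) with polylogarithmic depth and polynomial work. *)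

(* Defs.v *)
From mathcomp Require Import all_boot all_order all_algebra all_fingroup.
From mathcomp Require Import reals.

Set Implicit Arguments.
Unset Strict Implicit.
Unset Printing Implicit Defensive.

Import Order.TTheory GRing.Theory Num.Theory.

(** * Binary fork-join random-access machine

    Threads have private word registers and share a word memory.  The real
    numbers of the input sit in a separate read-only array, and a program can
    only compare two of its entries.  Every instruction has unit cost.
    Multiplication is deliberately not an instruction: with additions only,
    a computation of polylogarithmic depth produces words of polylogarithmic
    bit length, so that unit cost is harmless. *)

Inductive cmd : Type :=
| Skip
| Const of nat & nat              (* Const r c    : r := c *)
| Add of nat & nat & nat          (* Add r a b    : r := a + b *)
| Sub of nat & nat & nat          (* Sub r a b    : r := a - b, truncated *)
| Half of nat & nat               (* Half r a     : r := a / 2, rounded down *)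
| LoadMem of nat & nat            (* LoadMem r a  : r := mem[a] *)
| StoreMem of nat & nat           (* StoreMem a b : mem[a] := b *)
| CmpVal of nat & nat & nat       (* CmpVal r a b : r := (val[a] <= val[b]) *)
| Seq of cmd & cmd
| If of nat & cmd & cmd           (* If a c1 c2   : c1 when a != 0, else c2 *)
| Call of nat                     (* Call p       : run procedure number p *)
| Fork of cmd & cmd.

(* The list of procedure bodies; execution starts with procedure 0. *)
Definition program := seq cmd.

Definition store := nat -> nat.

Definition update (s : store) (x y : nat) : store :=
  fun z => if z == x then y else s z.

Record outcome := Outcome {
  o_regs : store;
  o_mem : store;
  o_reads : seq nat;   (* memory addresses loaded from *)
  o_writes : seq nat;  (* memory addresses stored to *)
  o_work : nat;
  o_depth : nat }.

Definition race_free (o1 o2 : outcome) : bool :=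
  ~~ has [in o_writes o1] (o_reads o2 ++ o_writes o2) &&
  ~~ has [in o_writes o2] (o_reads o1 ++ o_writes o1).

Definition seq_outcome (o1 o2 : outcome) : outcome :=
  Outcome (o_regs o2) (o_mem o2)
    (o_reads o1 ++ o_reads o2) (o_writes o1 ++ o_writes o2)
    (o_work o1 + o_work o2) (o_depth o1 + o_depth o2).

(* The children start from copies of the parent's registers, which are
   discarded at the join; results are communicated through the memory. *)
Definition fork_outcome (rho : store) (o1 o2 : outcome) : outcome :=
  Outcome rho
    (fun a => if a \in o_writes o1 then o_mem o1 a else o_mem o2 a)
    (o_reads o1 ++ o_reads o2) (o_writes o1 ++ o_writes o2)
    (o_work o1 + o_work o2).+1 (maxn (o_depth o1) (o_depth o2)).+1.

Definition tick (o : outcome) : outcome :=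
  Outcome (o_regs o) (o_mem o) (o_reads o) (o_writes o)
    (o_work o).+1 (o_depth o).+1.

(* [exec P val c rho mu o]: under program [P] and real input [val], command
   [c] started with registers [rho] and memory [mu] terminates with [o].
   A fork with a data race has no outcome; for race-free forks the outcome
   below is that of every interleaving. *)
Inductive exec (R : realType) (P : program) (val : nat -> R) :
  cmd -> store -> store -> outcome -> Prop :=
| exec_skip rho mu :
    exec P val Skip rho mu (Outcome rho mu [::] [::] 1 1)
| exec_const r c rho mu :
    exec P val (Const r c) rho mu
      (Outcome (update rho r c) mu [::] [::] 1 1)
| exec_add r a b rho mu :
    exec P val (Add r a b) rho mu
      (Outcome (update rho r (rho a + rho b)) mu [::] [::] 1 1)
| exec_sub r a b rho mu :
    exec P val (Sub r a b) rho mu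
      (Outcome (update rho r (rho a - rho b)) mu [::] [::] 1 1)
| exec_half r a rho mu :
    exec P val (Half r a) rho mu
      (Outcome (update rho r (rho a)./2) mu [::] [::] 1 1)
| exec_load r a rho mu :
    exec P val (LoadMem r a) rho mu
      (Outcome (update rho r (mu (rho a))) mu [:: rho a] [::] 1 1)
| exec_store a b rho mu :
    exec P val (StoreMem a b) rho mu
      (Outcome rho (update mu (rho a) (rho b)) [::] [:: rho a] 1 1)
| exec_cmpval r a b rho mu :
    exec P val (CmpVal r a b) rho mu
      (Outcome (update rho r (val (rho a) <= val (rho b))%R) mu
         [::] [::] 1 1)
| exec_seq c1 c2 rho mu o1 o2 :
    exec P val c1 rho mu o1 ->
    exec P val c2 (o_regs o1) (o_mem o1) o2 ->
    exec P val (Seq c1 c2) rho mu (seq_outcome o1 o2)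
| exec_if a c1 c2 rho mu o :
    exec P val (if rho a != 0 then c1 else c2) rho mu o ->
    exec P val (If a c1 c2) rho mu (tick o)
| exec_call p rho mu o :
    exec P val (nth Skip P p) rho mu o ->
    exec P val (Call p) rho mu (tick o)
| exec_fork c1 c2 rho mu o1 o2 :
    exec P val c1 rho mu o1 ->
    exec P val c2 rho mu o2 ->
    race_free o1 o2 ->
    exec P val (Fork c1 c2) rho mu (fork_outcome rho o1 o2).

Lemma exec_det (R : realType) (P : program) (val : nat -> R) c rho mu o o' :
  exec P val c rho mu o -> exec P val c rho mu o' -> o = o'.
Proof.
move=> E; elim: E o' => {c rho mu o}.
- by move=> rho mu o' E; inversion E.
- by move=> r c rho mu o' E; inversion E.
- by move=> r a b rho mu o' E; inversion E.
- by move=> r a b rho mu o' E; inversion E.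
- by move=> r a rho mu o' E; inversion E.
- by move=> r a rho mu o' E; inversion E.
- by move=> a b rho mu o' E; inversion E.
- by move=> r a b rho mu o' E; inversion E.
- move=> c1 c2 rho mu o1 o2 _ IH1 _ IH2 o' E; inversion E; subst.
  have e1 : o1 = o0 by exact: IH1.
  by subst o0; congr seq_outcome; exact: IH2.
- move=> a c1 c2 rho mu o _ IH o' E; inversion E; subst.
  by congr tick; exact: IH.
- move=> p rho mu o _ IH o' E; inversion E; subst.
  by congr tick; exact: IH.
- move=> c1 c2 rho mu o1 o2 _ IH1 _ IH2 _ o' E; inversion E; subst.
  by congr fork_outcome; [exact: IH1 | exact: IH2].
Qed.

Record input (R : realType) := Input {
  in_vals : seq R;      (* the read-only real array *)
  in_words : seq nat }. (* the initial memory, from address 0 on *)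

Definition input_size (R : realType) (x : input R) : nat :=
  size (in_vals x) + size (in_words x).

(* One program solves all the instances, with polynomial work and
   polylogarithmic depth; [post x mem] says that the final memory [mem] is a
   correct output on [x]. *)
Definition NC_solvable (R : realType) (X : Type) (encode : X -> input R)
    (post : X -> store -> Prop) : Prop :=
  exists (P : program) (c k : nat), forall x : X,
    let N := input_size (encode x) in
    exists o : outcome,
      [/\ exec P (nth 0%R (in_vals (encode x))) (Call 0)
            (fun=> 0) (nth 0 (in_words (encode x))) o,
          post x (o_mem o),
          o_work o <= c * N ^ k
        & o_depth o <= c * (trunc_log 2 N).+1 ^ k].

(** * Allocation of goods *)

(* The permutation [tie i] is agent [i]'s tie-breaking rule: among goods of
   equal value, the agent prefers the one with the smaller [tie i g].  Every
   ordering of the goods by nonincreasing value arises from some rule, see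
   [pref_list_surj]. *)
Record instance (R : realType) (n : nat) := Instance {
  goods : nat;
  value : 'I_n -> 'I_goods -> R;
  value_ge0 : forall i g, (0 <= value i g)%R;
  tie : 'I_n -> {perm 'I_goods} }.

Arguments value {R n} _ _ _.
Arguments tie {R n} _ _.

Section Allocation.
Variables (R : realType) (n : nat) (I : instance R n).

Definition bundle_value (i : 'I_n) (S : {set 'I_(goods I)}) : R :=
  (\sum_(g in S) value I i g)%R.

Definition prefers (i : 'I_n) : rel 'I_(goods I) := fun g h =>
  (value I i h < value I i g)%R ||
  (value I i g == value I i h) && (tie I i g <= tie I i h).

Definition pref_list (i : 'I_n) : seq 'I_(goods I) :=
  sort (prefers i) (enum 'I_(goods I)).

(* [A i] is the bundle of agent [i]; goods may be left unallocated. *)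
Definition assignment := {ffun 'I_n -> {set 'I_(goods I)}}.

Definition is_allocation (A : assignment) : Prop :=
  (forall i j, i != j -> [disjoint A i & A j]) /\
  \bigcup_i A i = [set: 'I_(goods I)].

(* An empty bundle has no good to remove and is never envied. *)
Definition EF1 (A : assignment) : Prop :=
  forall i j : 'I_n, A j != set0 ->
  exists2 s, s \in A j &
    (bundle_value i (A j :\ s) <= bundle_value i (A i))%R.

Definition take_best (A : assignment) (i : 'I_n) : assignment :=
  if [seq g <- pref_list i | g \notin \bigcup_j A j] is g :: _
  then [ffun j => if j == i then g |: A j else A j]
  else A.

Definition rr_round (sigma : {perm 'I_n}) (A : assignment) : assignment :=
  foldl take_best A [seq sigma k | k <- enum 'I_n].

(* When [n > 0] a round takes at least one good, if there is one left, so the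
   goods are exhausted after at most [goods I] rounds; the remaining rounds
   change nothing. *)
Definition round_robin (sigma : {perm 'I_n}) : assignment :=
  iter (goods I) (rr_round sigma) [ffun=> set0].

(* Memory: the number of goods, the agents in the order [sigma], the
   tie-breaking ranks agent by agent; real array: the values agent by agent. *)
Definition encode_instance (sigma : {perm 'I_n}) : input R :=
  Input
    [seq value I i g | i <- enum 'I_n, g <- enum 'I_(goods I)]
    (goods I :: [seq nat_of_ord (sigma k) | k <- enum 'I_n]
       ++ [seq nat_of_ord (tie I i g) | i <- enum 'I_n,
                                        g <- enum 'I_(goods I)]).

(* The final memory holds at address [g] the agent who receives good [g]. *)
Definition outputs_assignment (mem : store) (A : assignment) : Prop :=
  forall (i : 'I_n) (g : 'I_(goods I)),
    (g \in A i) = (mem g == i).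

Lemma prefers_total i : total (prefers i).
Proof.
move=> g h; rewrite /prefers.
by case: ltgtP => //= _; exact: leq_total.
Qed.

Lemma prefers_trans i : transitive (prefers i).
Proof.
move=> h g k; rewrite /prefers.
move=> /orP[gh|/andP[/eqP -> gh]] /orP[hk|/andP[/eqP e hk]].
- by rewrite (lt_trans hk gh).
- by rewrite -e gh.
- by rewrite hk.
- by rewrite e eqxx (leq_trans gh hk) orbT.
Qed.

Lemma prefers_anti i : antisymmetric (prefers i).
Proof.
move=> g h; rewrite /prefers; case: ltgtP => //= _ e.
by apply: (@perm_inj _ (tie I i)); apply/val_inj/eqP; rewrite eqn_leq.
Qed.

Lemma pref_list_perm i : perm_eq (pref_list i) (enum 'I_(goods I)).
Proof. by rewrite perm_sort. Qed.

Lemma pref_list_sorted i :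
  sorted (fun g h => value I i h <= value I i g)%R (pref_list i).
Proof.
apply: sub_sorted (sort_sorted (@prefers_total i) _) => g h.
by case/orP=> [/ltW //|/andP[/eqP -> _]].
Qed.

End Allocation.

Lemma pref_list_surj (R : realType) (n m : nat) (v : 'I_n -> 'I_m -> R)
    (v_ge0 : forall i g, (0 <= v i g)%R) (L : 'I_n -> seq 'I_m) :
    (forall i, perm_eq (L i) (enum 'I_m)) ->
    (forall i, sorted (fun g h => v i h <= v i g)%R (L i)) ->
  exists t : 'I_n -> {perm 'I_m}, forall i, pref_list (Instance v_ge0 t) i = L i.
Proof.
move=> Lperm Lsort.
have Lin i g : g \in L i by rewrite (perm_mem (Lperm i)) mem_enum.
have Lsz i : size (L i) = m by rewrite (perm_size (Lperm i)) size_enum_ord.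
have Lun i : uniq (L i) by rewrite (perm_uniq (Lperm i)) enum_uniq.
have ltm i g : index g (L i) < m by rewrite -{2}(Lsz i) index_mem.
pose f i g := Ordinal (ltm i g).
have f_inj i : injective (f i).
  by move=> g h [] e; rewrite -(nth_index g (Lin i g)) e nth_index.
exists (fun i => perm (@f_inj i)) => i.
set I := Instance _ _.
apply: (sorted_eq (@prefers_trans _ _ I i) (@prefers_anti _ _ I i)).
- exact/sort_sorted/prefers_total.
- have [->//|[x0 _]] : L i = [::] \/ exists x : 'I_m, True.
    by case: (L i) => [|x s]; [left | right; exists x].
  apply/(sortedP x0) => k ltk.
  have /(sortedP x0)/(_ k ltk) := Lsort i.
  rewrite /prefers /= !permE /= !index_uniq ?leqnSn ?andbT //; last exact: ltnW.
  by rewrite le_eqVlt orbC eq_sym.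
- by rewrite (permPl (pref_list_perm I i)) perm_sym Lperm.
Qed.

(* Main.v *)
Require Import Defs.
From mathcomp Require Import all_boot all_order all_algebra all_fingroup.
From mathcomp Require Import reals zify.

(** For a fixed number of agents Round Robin has only polynomially many
    configurations, so the sequential run can be shortcut by pointer doubling.
    The goods already taken are exactly those that some agent [j] likes at least
    as much as the good [j] picked last.  Hence a configuration is given by the
    last pick of every agent, whose turn it is, and the progress of a linear scan
    for the best remaining good.  These are [n + 3] numbers below
    [B = 2 ^ w = O(n + m)], packed into a code below [B ^ (n + 3)], and one step
    of the scan is a map on codes computed in time [O(w)].  Tabulating that map
    for all codes in parallel and squaring it repeatedly gives all its
    [2 ^ k]-fold iterates; a binary fork tree then visits every configuration of
    the run and writes the picks made there.

    For EF1, the value of the good that agent [i] took in a round bounds the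
    value (to [i]) of everything left after that round, hence of whatever agent
    [j] takes in the next one. *)

(** The description of the taken goods is exact. An agent takes the best free good, so everything
    [j] likes at least as much as its last pick is gone after that pick. Conversely, since the free
    goods only shrink, [j] likes each good it took at least as much as its later picks. One good per
    agent thus replaces a subset of the goods, which makes the code space polynomial for constant
    [n]. Finding the best free good within one transition would need a search over all goods;
    spreading it over [m + 1] configurations leaves a step that only loops over the agents. The
    tables cover all codes, most of them unreachable, so digits and addresses must be bounded for
    arbitrary codes. The run has [m n (m + 1) <= B ^ 3] steps. The walk makes [2 ^ L] steps, and
    those beyond the run emit nothing, as no good is left. Each good passes from free to taken only
    once, so the parallel writes of the walk hit distinct addresses. *)

Set Implicit Arguments.
Unset Strict Implicit.
Unset Printing Implicit Defensive.

Import Order.TTheory GRing.Theory Num.Theory.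

(** * Program logic *)

Section ProgramLogic.
Variables (R : realType) (P : program) (val : nat -> R).

Lemma exec_mem_frame c rho mu o :
  exec P val c rho mu o ->
  forall a, a \notin o_writes o -> o_mem o a = mu a.
Proof.
elim=> {c rho mu o} //=.
- by move=> a b rho mu x; rewrite inE /update => /negPf ->.
- move=> c1 c2 rho mu o1 o2 _ IH1 _ IH2 a.
  by rewrite mem_cat negb_or => /andP[a1 a2]; rewrite IH2 // IH1.
- move=> c1 c2 rho mu o1 o2 _ IH1 _ IH2 _ a.
  by rewrite mem_cat negb_or => /andP[/negPf -> a2]; rewrite IH2.
Qed.

(* Weakest precondition of code without stores and forks, for which work and
   depth agree; [k] is the cost incurred so far. *)
Definition wp c rho mu (RD : nat -> Prop) k (Q : store -> nat -> Prop) : Prop :=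
  exists rho' rd w,
    [/\ exec P val c rho mu (Outcome rho' mu rd [::] w w),
        {in rd, forall a, RD a} & Q rho' (k + w)].

(** Footprints and costs are bounded from above rather than computed: the bounds suffice for race
    freedom and compose through branches and forks. *)
Definition runs c rho mu (RD WR : nat -> Prop) w d
    (Q : store -> store -> Prop) : Prop :=
  exists o,
    [/\ exec P val c rho mu o, {in o_reads o, forall a, RD a},
        {in o_writes o, forall a, WR a}, Q (o_regs o) (o_mem o)
      & o_work o <= w /\ o_depth o <= d].

Lemma wp_skip rho mu RD k (Q : store -> nat -> Prop) :
  Q rho (k + 1) -> wp Skip rho mu RD k Q.
Proof. by exists rho, [::], 1; split=> //; constructor. Qed.

Lemma wp_const r x rho mu RD k (Q : store -> nat -> Prop) :
  Q (update rho r x) (k + 1) -> wp (Const r x) rho mu RD k Q.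
Proof. by exists (update rho r x), [::], 1; split=> //; constructor. Qed.

Lemma wp_add r a b rho mu RD k (Q : store -> nat -> Prop) :
  Q (update rho r (rho a + rho b)) (k + 1) -> wp (Add r a b) rho mu RD k Q.
Proof.
by exists (update rho r (rho a + rho b)), [::], 1; split=> //; constructor.
Qed.

Lemma wp_sub r a b rho mu RD k (Q : store -> nat -> Prop) :
  Q (update rho r (rho a - rho b)) (k + 1) -> wp (Defs.Sub r a b) rho mu RD k Q.
Proof.
by exists (update rho r (rho a - rho b)), [::], 1; split=> //; constructor.
Qed.

Lemma wp_half r a rho mu RD k (Q : store -> nat -> Prop) :
  Q (update rho r (rho a)./2) (k + 1) -> wp (Half r a) rho mu RD k Q.
Proof.
by exists (update rho r (rho a)./2), [::], 1; split=> //; constructor.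
Qed.

Lemma wp_load r a rho mu (RD : nat -> Prop) k (Q : store -> nat -> Prop) :
  RD (rho a) -> Q (update rho r (mu (rho a))) (k + 1) ->
  wp (LoadMem r a) rho mu RD k Q.
Proof.
move=> rd; exists (update rho r (mu (rho a))), [:: rho a], 1.
by split=> // [|x /[1!inE] /eqP ->//]; constructor.
Qed.

Lemma wp_cmpval r a b rho mu RD k (Q : store -> nat -> Prop) :
  Q (update rho r (val (rho a) <= val (rho b))%R) (k + 1) ->
  wp (CmpVal r a b) rho mu RD k Q.
Proof.
by exists (update rho r (val (rho a) <= val (rho b))%R), [::], 1; split=> //;
   constructor.
Qed.

Lemma wp_seq c1 c2 rho mu RD k (Q : store -> nat -> Prop) :
  wp c1 rho mu RD k (fun rho' k' => wp c2 rho' mu RD k' Q) ->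
  wp (Seq c1 c2) rho mu RD k Q.
Proof.
move=> [rho1 [rd1 [w1 [E1 R1 [rho2 [rd2 [w2 [E2 R2 q]]]]]]]].
exists rho2, (rd1 ++ rd2), (w1 + w2); split; last by rewrite addnA.
- exact: exec_seq E1 E2.
- by move=> a; rewrite mem_cat => /orP[/R1|/R2].
Qed.

Lemma wp_if a c1 c2 rho mu RD k (Q : store -> nat -> Prop) :
  wp (if rho a != 0 then c1 else c2) rho mu RD (k + 1) Q ->
  wp (If a c1 c2) rho mu RD k Q.
Proof.
move=> [rho' [rd [w [E Rd q]]]]; exists rho', rd, w.+1; split=> //.
  exact: exec_if E.
by have -> : k + w.+1 = k + 1 + w by lia.
Qed.

Lemma wp_call p rho mu RD k (Q : store -> nat -> Prop) :
  wp (nth Skip P p) rho mu RD (k + 1) Q -> wp (Call p) rho mu RD k Q.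
Proof.
move=> [rho' [rd [w [E Rd q]]]]; exists rho', rd, w.+1; split=> //.
  exact: exec_call E.
by have -> : k + w.+1 = k + 1 + w by lia.
Qed.

Lemma wp_rep N c rho mu RD k (J : nat -> store -> nat -> Prop)
    (Q : store -> nat -> Prop) :
  J 0 rho k ->
  (forall j rho k, j < N -> J j rho k -> wp c rho mu RD k (J j.+1)) ->
  (forall rho k, J N rho k -> Q rho (k + 1)) ->
  wp (iter N (Seq c) Skip) rho mu RD k Q.
Proof.
move=> J0 JS JQ.
(* The induction is on the iterations left, while [J] counts those done; the final [Skip] is the
   extra unit of cost. *)
suff H i rho' k' : i <= N -> J (N - i) rho' k' ->
    wp (iter i (Seq c) Skip) rho' mu RD k' Q.
  by apply: H => //; rewrite subnn.
elim: i rho' k' => [|i IH] rho' k' iN Ji.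
  by apply: wp_skip; apply: JQ; rewrite -[N]subn0.
rewrite iterS; apply: wp_seq.
have lt_N : N - i.+1 < N by lia.
have [rho1 [rd [w [E Rd q]]]] := JS _ _ _ lt_N Ji.
exists rho1, rd, w; split=> //; apply: IH; first lia.
by have <- : (N - i.+1).+1 = N - i by lia.
Qed.

Lemma runs_wp c rho mu (RD WR : nat -> Prop) w d (Q : store -> store -> Prop) :
  wp c rho mu RD 0 (fun rho' k => [/\ Q rho' mu, k <= w & k <= d]) ->
  runs c rho mu RD WR w d Q.
Proof.
move=> [rho' [rd [k [E Rd [q kw kd]]]]].
by exists (Outcome rho' mu rd [::] k k).
Qed.

(** The new postcondition may use that memory is unchanged outside [WR]; this carries earlier tables
    through later phases. *)
Lemma runs_weaken c rho mu (RD RD' WR WR' : nat -> Prop) w w' d d'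
    (Q Q' : store -> store -> Prop) :
  runs c rho mu RD WR w d Q ->
  (forall a, RD a -> RD' a) -> (forall a, WR a -> WR' a) ->
  w <= w' -> d <= d' ->
  (forall rho' mu', (forall a, ~ WR a -> mu' a = mu a) ->
     Q rho' mu' -> Q' rho' mu') ->
  runs c rho mu RD' WR' w' d' Q'.
Proof.
move=> [o [E Rd Wr q [ow od]]] RR WW ww dd QQ; exists o; split=> //.
- by move=> a /Rd/RR.
- by move=> a /Wr/WW.
- apply: QQ q => a na; apply: (exec_mem_frame E).
  by apply/negP => /Wr.
- by split; [exact: leq_trans ww | exact: leq_trans dd].
Qed.

Lemma runs_store a b rho mu (RD WR : nat -> Prop) (Q : store -> store -> Prop) :
  WR (rho a) -> Q rho (update mu (rho a) (rho b)) ->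
  runs (StoreMem a b) rho mu RD WR 1 1 Q.
Proof.
move=> wr q; exists (Outcome rho (update mu (rho a) (rho b)) [::] [:: rho a] 1 1).
by split=> // [|x /[1!inE] /eqP ->//]; constructor.
Qed.

Lemma runs_seq c1 c2 rho mu (RD WR : nat -> Prop) w1 d1 w2 d2
    (Q : store -> store -> Prop) :
  runs c1 rho mu RD WR w1 d1
    (fun rho' mu' => runs c2 rho' mu' RD WR w2 d2 Q) ->
  runs (Seq c1 c2) rho mu RD WR (w1 + w2) (d1 + d2) Q.
Proof.
move=> [o1 [E1 R1 W1 [o2 [E2 R2 W2 q [w2' d2']]] [w1' d1']]].
exists (seq_outcome o1 o2); split=> //=.
- exact: exec_seq E1 E2.
- by move=> a; rewrite mem_cat => /orP[/R1|/R2].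
- by move=> a; rewrite mem_cat => /orP[/W1|/W2].
- by split; apply: leq_add.
Qed.

Lemma runs_wp_seq c1 c2 rho mu (RD WR : nat -> Prop) k1 w2 d2
    (Q : store -> store -> Prop) :
  wp c1 rho mu RD 0
    (fun rho' k => runs c2 rho' mu RD WR w2 d2 Q /\ k <= k1) ->
  runs (Seq c1 c2) rho mu RD WR (k1 + w2) (k1 + d2) Q.
Proof.
move=> [rho' [rd [k [E Rd [q kk]]]]]; apply: runs_seq.
by exists (Outcome rho' mu rd [::] k k).
Qed.

Lemma runs_if a c1 c2 rho mu (RD WR : nat -> Prop) w d
    (Q : store -> store -> Prop) :
  runs (if rho a != 0 then c1 else c2) rho mu RD WR w d Q ->
  runs (If a c1 c2) rho mu RD WR w.+1 d.+1 Q.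
Proof.
move=> [o [E Rd Wr q ?]]; exists (tick o).
by split=> //; exact: exec_if E.
Qed.

Lemma runs_call p rho mu (RD WR : nat -> Prop) w d
    (Q : store -> store -> Prop) :
  runs (nth Skip P p) rho mu RD WR w d Q ->
  runs (Call p) rho mu RD WR w.+1 d.+1 Q.
Proof.
move=> [o [E Rd Wr q ?]]; exists (tick o).
by split=> //; exact: exec_call E.
Qed.

(** Where neither child writes, both final memories equal [mu]. Hence the merged memory agrees with
    each child's own memory wherever the other child does not write, and both postconditions can be
    transferred symmetrically. *)
Lemma runs_fork c1 c2 rho mu (RD1 RD2 WR1 WR2 : nat -> Prop) w1 w2 d1 d2
    (Q1 Q2 : store -> store -> Prop) :
  runs c1 rho mu RD1 WR1 w1 d1 Q1 ->
  runs c2 rho mu RD2 WR2 w2 d2 Q2 ->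
  (forall a, WR1 a -> ~ RD2 a /\ ~ WR2 a) ->
  (forall a, WR2 a -> ~ RD1 a) ->
  runs (Fork c1 c2) rho mu (fun a => RD1 a \/ RD2 a) (fun a => WR1 a \/ WR2 a)
    (w1 + w2).+1 (maxn d1 d2).+1
    (fun rho' mu' => rho' = rho /\
       exists rho1 mu1 rho2 mu2,
         [/\ Q1 rho1 mu1, Q2 rho2 mu2,
             forall a, ~ WR2 a -> mu' a = mu1 a
           & forall a, ~ WR1 a -> mu' a = mu2 a]).
Proof.
move=> [o1 [E1 R1 W1 q1 [w1' d1']]] [o2 [E2 R2 W2 q2 [w2' d2']]] H12 H21.
exists (fork_outcome rho o1 o2); split=> /=.
- apply: exec_fork => //; rewrite /race_free -!all_predC; apply/andP; split.
    apply/allP => a; rewrite mem_cat /= => ha; apply/negP => /W1/H12[nr nw].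
    by case/orP: ha => [/R2|/W2].
  apply/allP => a; rewrite mem_cat /= => ha; apply/negP => /W2 wa.
  by case/orP: ha => [/R1/(H21 _ wa)//|/W1/H12[_]].
- by move=> a; rewrite mem_cat => /orP[/R1|/R2]; [left|right].
- by move=> a; rewrite mem_cat => /orP[/W1|/W2]; [left|right].
- split=> //; exists (o_regs o1), (o_mem o1), (o_regs o2), (o_mem o2); split=> // a na.
    case: ifPn => // a1; rewrite (exec_mem_frame E1) // (exec_mem_frame E2) //.
    by apply/negP => /W2.
  by case: ifPn => // /W1.
- split; rewrite ltnS; [exact: leq_add | rewrite geq_max !leq_max d1' d2' orbT //].
Qed.

End ProgramLogic.

(** * The program *)

(* [rZ] is never written, so it stays 0; [rOne] .. [rS] hold, after [setup],
   the number 1, the number [m] of goods, the digit width [w], the code width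
   [L = (n + 3) w] and the number [2 ^ L] of codes. *)
Local Notation rZ := 0 (only parsing).
Local Notation rOne := 1 (only parsing).
Local Notation rM := 2 (only parsing).
Local Notation rW := 3 (only parsing).
Local Notation rL := 4 (only parsing).
Local Notation rS := 5 (only parsing).
Local Notation rX := 6 (only parsing).
Local Notation rC := 7 (only parsing).
Local Notation rY := 8 (only parsing).
Local Notation rD := 9 (only parsing).
Local Notation rRem := 10 (only parsing).
Local Notation rCode := 11 (only parsing).
Local Notation rK := 12 (only parsing).
Local Notation rH := 13 (only parsing).
Local Notation rB := 14 (only parsing).
Local Notation rT := 15 (only parsing).
Local Notation rA := 16 (only parsing).
Local Notation rScan := 17 (only parsing).
Local Notation rJ := 18 (only parsing).
Local Notation rVal := 19 (only parsing).
Local Notation rTie := 20 (only parsing).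
Local Notation rOk := 21 (only parsing).
Local Notation rAcc := 22 (only parsing).
Local Notation rSh := 23 (only parsing).
Local Notation rG := 24 (only parsing).
Local Notation rU := 25 (only parsing).
Local Notation rV := 26 (only parsing).
Local Notation rP := 27 (only parsing).
Local Notation rQ := 28 (only parsing).
Local Notation rE := 29 (only parsing).
Local Notation rN := 30 (only parsing).
Local Notation rBase := 31 (only parsing).
Local Notation rCnt := 32 (only parsing).
Local Notation rEA := 33 (only parsing).
Local Notation rEG := 34 (only parsing).

Local Notation "c1 ;; c2" := (Seq c1 c2) (at level 90, right associativity).
Local Notation mov r a := (Add r a rZ).
Local Notation Sub := Defs.Sub.
Local Notation pShl := 1 (only parsing).
Local Notation pShr := 2 (only parsing).
Local Notation pDigit := 3 (only parsing).
Local Notation pPref := 4 (only parsing).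
Local Notation pBits := 5 (only parsing).
Local Notation pFirst := 6 (only parsing).
Local Notation pSquare := 7 (only parsing).
Local Notation pDouble := 8 (only parsing).
Local Notation pWalk := 9 (only parsing).

Arguments update s x y z /.

Definition same_but (F : seq nat) (rho rho' : store) :=
  forall r, r \notin F -> rho' r = rho r.

Lemma notin_eqF (F : seq nat) r : r \notin F -> forall x, x \in F -> (r == x) = false.
Proof. by move=> nr x xF; apply: contraNF nr => /eqP ->. Qed.

(** Reads of concrete registers outside the changed set are traced back to the older state; [isT]
    proves the non-membership by computation. *)
Ltac use_same H := match type of H with same_but _ _ ?rho' =>
  repeat match goal with |- context [rho' ?r] => rewrite (H r isT) /= end end.

(** Proves [same_but] across nested updates and earlier [same_but] facts, for a register known only
    to differ from the listed ones. *)
Ltac frame := let F := fresh in let r := fresh "r" in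
  move=> r /notin_eqF F;
  repeat (rewrite /= ?F //=;
    match goal with H : same_but _ _ ?rho' |- context [?rho' r] =>
      rewrite (H r); last by rewrite !inE ?F end);
  rewrite /= ?F //=.

(** Horner's rule, the form in which [repack] assembles a code and in which division peels off its
    lowest digit. *)
Lemma sum_digits_recl b (f : nat -> nat) N :
  \sum_(i < N.+1) f i * b ^ i = (\sum_(i < N) f i.+1 * b ^ i) * b + f 0.
Proof.
rewrite big_ord_recl /= muln1 addnC; congr (_ + _).
by rewrite big_distrl /=; apply: eq_bigr => i _; rewrite /bump /= expnSr mulnA.
Qed.

Section Program.
Variable n : nat.

(** Without multiplication, scaling is repeated doubling; this is why the digit base and the block
    size are powers of two. *)
Definition shl_body : cmd :=
  If rC (Add rX rX rX ;; Sub rC rC rOne ;; Call pShl) Skip.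

Definition shr_body : cmd :=
  If rC (Half rY rY ;; Sub rC rC rOne ;; Call pShr) Skip.

Definition digit_body : cmd :=
  mov rY rRem ;; mov rC rW ;; Call pShr ;;
  mov rX rY ;; mov rC rW ;; Call pShl ;;
  Sub rD rRem rX ;; mov rRem rY.

(** [rVal] and [rTie] point to the rows of one agent. [rP] starts as the weak comparison of values
    and is cleared only when the values tie and the truncated difference of ranks is nonzero, that
    is, when [rH] loses the tie. *)
Definition pref_body : cmd :=
  Add rU rVal rH ;; Add rV rVal rG ;;
  CmpVal rP rV rU ;; CmpVal rQ rU rV ;;
  Add rU rTie rH ;; Add rV rTie rG ;;
  LoadMem rU rU ;; LoadMem rV rV ;; Sub rU rU rV ;;
  If rP (If rQ (If rU (Const rP 0) Skip) Skip) Skip.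

Definition bits_body : cmd :=
  If rY (Half rY rY ;; Add rW rW rOne ;; Call pBits) Skip.

(** If agent [rJ] likes the candidate [rH] at least as much as its last pick, then the candidate is
    already taken. *)
Definition reject_taken : cmd :=
  If rD (Sub rG rD rOne ;; Call pPref ;; If rP (Const rOk 0) Skip) Skip.

(** Acts only when [rE = 0], the iteration of the agent on turn, because only then do [rVal] and
    [rTie] point to that agent's rows. Once the scan is over, the best good becomes its last
    pick. *)
Definition compare_best : cmd :=
  If rE Skip
    (If rB (Sub rG rB rOne ;; Call pPref ;; If rP Skip (Const rOk 0) ;;
            If rScan Skip (mov rN rB)) Skip).

Definition agent_loop_body : cmd :=
  Call pDigit ;; mov rN rD ;; reject_taken ;;
  Sub rE rJ rA ;; Sub rU rA rJ ;; Add rE rE rU ;; compare_best ;;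
  mov rX rN ;; mov rC rSh ;; Call pShl ;; Add rAcc rAcc rX ;;
  Add rSh rSh rW ;; Add rJ rJ rOne ;; Add rVal rVal rM ;; Add rTie rTie rM.

(* Digits of a code, in base [2 ^ w]: the number of goods scanned so far, the
   best good found, the number of the turn in the current round, then the last
   pick of every agent.  Goods are stored shifted by one, 0 meaning none. *)
Definition unpack : cmd :=
  mov rRem rCode ;;
  Call pDigit ;; mov rH rD ;; Call pDigit ;; mov rB rD ;;
  Call pDigit ;; mov rT rD ;;
  Add rU rT rOne ;; LoadMem rA rU ;; Sub rScan rM rH ;;
  mov rJ rZ ;; mov rVal rZ ;; Const rTie n.+1 ;; mov rOk rOne ;;
  mov rAcc rZ ;; mov rSh rZ.

(** [rEG] is saved before [rB] is overwritten. In the scanning branch [rB] receives the incremented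
    [rH], which is the scanned good in its shifted representation. *)
Definition repack : cmd :=
  Sub rEG rB rOne ;;
  If rScan
    (Add rH rH rOne ;; If rOk (mov rB rH) Skip ;; mov rEA rZ)
    (If rB (Add rEA rA rOne) (mov rEA rZ) ;;
     mov rH rZ ;; mov rB rZ ;; Add rT rT rOne ;; Const rU n ;;
     Sub rU rU rT ;; If rU Skip (mov rT rZ)) ;;
  mov rX rAcc ;; mov rC rW ;; Call pShl ;; Add rX rX rT ;;
  mov rC rW ;; Call pShl ;; Add rX rX rB ;;
  mov rC rW ;; Call pShl ;; Add rX rX rH.

Definition transition : cmd :=
  unpack ;; iter n (Seq agent_loop_body) Skip ;; repack.

Definition first_leaf : cmd :=
  transition ;; Add rU rCode rS ;; StoreMem rU rEA ;; Add rU rU rS ;; StoreMem rU rEG ;;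
  Add rU rU rS ;; StoreMem rU rX.

Definition square_leaf : cmd :=
  Add rU rBase rCode ;; LoadMem rU rU ;; Add rU rBase rU ;; LoadMem rU rU ;;
  Add rV rBase rCode ;; Add rV rV rS ;; StoreMem rV rU.

(** [rCode] holds the leading bits chosen so far, [rK] the number of bits still to choose. *)
Definition for_all_codes p leaf : cmd :=
  If rK
    (Sub rK rK rOne ;; Add rCode rCode rCode ;;
     Fork (Call p) (Add rCode rCode rOne ;; Call p))
    leaf.

Definition double_body : cmd :=
  If rCnt
    (mov rK rL ;; mov rCode rZ ;; Fork (Call pSquare) Skip ;;
     Add rBase rBase rS ;; Sub rCnt rCnt rOne ;; Call pDouble)
    Skip.

Definition walk_leaf : cmd :=
  Add rU rCode rS ;; LoadMem rE rU ;;
  If rE (Add rU rU rS ;; LoadMem rG rU ;; Sub rE rE rOne ;; StoreMem rG rE) Skip.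

(** After the decrements [rBase] is the block of the [2 ^ rK]-fold iterate, so the right child
    starts exactly where the left child's stretch ends. *)
Definition walk_body : cmd :=
  If rK
    (Sub rK rK rOne ;; Sub rBase rBase rS ;;
     Fork (Call pWalk)
          (Add rU rBase rCode ;; LoadMem rCode rU ;; Call pWalk))
    walk_leaf.

Definition setup : cmd :=
  Const rOne 1 ;; LoadMem rM rZ ;; Const rY n ;; Add rY rY rM ;;
  Call pBits ;; iter n.+3 (Seq (Add rL rL rW)) Skip ;;
  Const rX 1 ;; mov rC rL ;; Call pShl ;; mov rS rX ;; mov rK rL.

(* Memory, in blocks of [2 ^ L] words indexed by codes: block 0 holds the input
   and receives the output, block 1 the agent served in the configuration (plus
   one; 0 if no good is assigned there), block 2 the good assigned, block [3 + k]
   the [2 ^ k]-fold iterate of the transition map.  The walk overwrites the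
   input, which is why blocks 1 and 2 are needed.  [Fork c Skip] runs [c] and
   restores the registers. *)
Definition main_body : cmd :=
  setup ;; Fork (Call pFirst) Skip ;;
  (Add rBase rS rS ;; Add rBase rBase rS ;; mov rCnt rL) ;; Call pDouble ;;
  (mov rK rL ;; mov rCode rZ) ;; Call pWalk.

Definition rr_program : program :=
  [:: main_body; shl_body; shr_body; digit_body; pref_body; bits_body;
      for_all_codes pFirst first_leaf; for_all_codes pSquare square_leaf;
      double_body; walk_body].

(** * Effect and cost of the code without stores and forks *)

Section Straight.
Variables (R : realType) (val : nat -> R) (mu : store) (RD : nat -> Prop).

Local Notation wp := (wp rr_program val).

Lemma wp_shl rho k (Q : store -> nat -> Prop) :
  rho rOne = 1 ->
  (forall rho', same_but [:: rX; rC] rho rho' ->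
     rho' rX = rho rX * 2 ^ rho rC ->
     Q rho' (k + (4 * rho rC + 3))) ->
  wp (Call pShl) rho mu RD k Q.
Proof.
move=> one; move eC: (rho rC) => x.
elim: x rho k Q one eC => [|x IH] rho k Q one eC HQ; apply: wp_call => /=; apply: wp_if; rewrite eC /=.
  apply: wp_skip; have -> : k + 1 + 1 + 1 = k + (4 * 0 + 3) by lia.
  by apply: HQ => //; rewrite muln1.
apply: wp_seq; apply: wp_add; apply: wp_seq; apply: wp_sub => /=; rewrite eC one.
apply: IH => /= [|| rho' same e].
  by []. by rewrite subn1.
have -> : k + 1 + 1 + 1 + 1 + (4 * x + 3) = k + (4 * x.+1 + 3) by lia.
apply: HQ => [r hr|].
  by rewrite same //=; move: hr; rewrite !inE; do 2 case: eqP => //=.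
by rewrite e expnS mulnA muln2 addnn.
Qed.

Lemma wp_shr rho k (Q : store -> nat -> Prop) :
  rho rOne = 1 ->
  (forall rho', same_but [:: rY; rC] rho rho' ->
     rho' rY = rho rY %/ 2 ^ rho rC ->
     Q rho' (k + (4 * rho rC + 3))) ->
  wp (Call pShr) rho mu RD k Q.
Proof.
move=> one; move eC: (rho rC) => x.
elim: x rho k Q one eC => [|x IH] rho k Q one eC HQ; apply: wp_call => /=; apply: wp_if; rewrite eC /=.
  apply: wp_skip; have -> : k + 1 + 1 + 1 = k + (4 * 0 + 3) by lia.
  by apply: HQ => //; rewrite divn1.
apply: wp_seq; apply: wp_half; apply: wp_seq; apply: wp_sub => /=; rewrite eC one.
apply: IH => /= [|| rho' same e].
  by []. by rewrite subn1.
have -> : k + 1 + 1 + 1 + 1 + (4 * x + 3) = k + (4 * x.+1 + 3) by lia.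
apply: HQ; first by frame.
by rewrite e -divn2 -divnMA expnS.
Qed.

Lemma wp_digit rho k (Q : store -> nat -> Prop) :
  rho rZ = 0 -> rho rOne = 1 ->
  (forall rho', same_but [:: rX; rC; rY; rD; rRem] rho rho' ->
     rho' rD = rho rRem %% 2 ^ rho rW ->
     rho' rRem = rho rRem %/ 2 ^ rho rW ->
     Q rho' (k + (8 * rho rW + 13))) ->
  wp (Call pDigit) rho mu RD k Q.
Proof.
move=> zero one HQ; apply: wp_call => /=.
apply: wp_seq; apply: wp_add; apply: wp_seq; apply: wp_add => /=; rewrite zero !addn0.
apply: wp_seq; apply: wp_shr => //= rho1 s1 e1.
apply: wp_seq; apply: wp_add; apply: wp_seq; apply: wp_add => /=; use_same s1.
rewrite e1 zero !addn0.
apply: wp_seq; apply: wp_shl => /= [|rho2 s2 e2]; first by use_same s1.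
apply: wp_seq; apply: wp_sub; apply: wp_add => /=.
set k' := _ + 1; have -> : k' = k + (8 * rho rW + 13) by rewrite /k'; lia.
apply: HQ; first by frame.
  rewrite /=; use_same s2; use_same s1; rewrite e2.
  by rewrite {1}(divn_eq (rho rRem) (2 ^ rho rW)) addKn.
by rewrite /=; use_same s2; use_same s1; rewrite e1 zero addn0.
Qed.

Definition pref_code v t h g : bool :=
  (val (v + g) <= val (v + h))%R &&
  (~~ (val (v + h) <= val (v + g))%R || (mu (t + h) <= mu (t + g))).

Lemma wp_pref rho k (Q : store -> nat -> Prop) :
  RD (rho rTie + rho rH) -> RD (rho rTie + rho rG) ->
  (forall rho' k', same_but [:: rU; rV; rP; rQ] rho rho' ->
     rho' rP = pref_code (rho rVal) (rho rTie) (rho rH) (rho rG) ->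
     k' <= k + 14 -> Q rho' k') ->
  wp (Call pPref) rho mu RD k Q.
Proof.
move=> r1 r2 HQ; apply: wp_call => /=.
do 2 (apply: wp_seq; apply: wp_add); do 2 (apply: wp_seq; apply: wp_cmpval).
do 2 (apply: wp_seq; apply: wp_add); do 2 (apply: wp_seq; apply: wp_load => //=).
apply: wp_seq; apply: wp_sub => /=.
apply: wp_if => /=; case c1: (_ <= _)%R => /=; last first.
  apply: wp_skip; apply: HQ; last lia; first by frame.
  by rewrite /= /pref_code c1.
apply: wp_if => /=; case c2: (_ <= _)%R => /=; last first.
  apply: wp_skip; apply: HQ; last lia; first by frame.
  by rewrite /= /pref_code c1 c2.
apply: wp_if => /=; rewrite subn_eq0; case c3: (_ <= _) => /=.
  apply: wp_skip; apply: HQ; last lia; first by frame.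
  by rewrite /= /pref_code c1 c2 c3.
apply: wp_const; apply: HQ; last lia; first by frame.
by rewrite /= /pref_code c1 c2 c3.
Qed.


Lemma wp_reject_taken rho k (Q : store -> nat -> Prop) :
  rho rOne = 1 ->
  RD (rho rTie + rho rH) -> RD (rho rTie + (rho rD).-1) ->
  (forall rho' k', same_but [:: rG; rU; rV; rP; rQ; rOk] rho rho' ->
     rho' rOk = (if (rho rD != 0) &&
                    pref_code (rho rVal) (rho rTie) (rho rH) (rho rD).-1
                 then 0 else rho rOk) ->
     k' <= k + 20 -> Q rho' k') ->
  wp reject_taken rho mu RD k Q.
Proof.
move=> one r1 r2 HQ; apply: wp_if; have [d0|d0] := eqVneq (rho rD) 0 => /=.
  by apply: wp_skip; apply: HQ => //; [rewrite d0 | lia].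
apply: wp_seq; apply: wp_sub => /=; rewrite one subn1.
apply: wp_seq; apply: wp_pref => //= rho1 k1 s1 e1 lk.
apply: wp_if; rewrite e1; case p: (pref_code _ _ _ _) => /=.
  by apply: wp_const; apply: HQ; [frame | rewrite /= d0 p | lia].
by apply: wp_skip; apply: HQ; [frame | rewrite /= d0 p /=; use_same s1 | lia].
Qed.

Lemma wp_compare_best rho k (Q : store -> nat -> Prop) :
  rho rZ = 0 -> rho rOne = 1 ->
  RD (rho rTie + rho rH) -> RD (rho rTie + (rho rB).-1) ->
  (forall rho' k', same_but [:: rG; rU; rV; rP; rQ; rOk; rN] rho rho' ->
     rho' rOk = (if [&& rho rE == 0, rho rB != 0 &
                    ~~ pref_code (rho rVal) (rho rTie) (rho rH) (rho rB).-1]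
                 then 0 else rho rOk) ->
     rho' rN = (if [&& rho rE == 0, rho rB != 0 & rho rScan == 0]
                then rho rB else rho rN) ->
     k' <= k + 25 -> Q rho' k') ->
  wp compare_best rho mu RD k Q.
Proof.
move=> zero one r1 r2 HQ; apply: wp_if; have [e0|e0] := eqVneq (rho rE) 0 => /=; last first.
  by apply: wp_skip; apply: HQ => //; rewrite ?(negPf e0) //; lia.
apply: wp_if; have [d0|d0] := eqVneq (rho rB) 0 => /=.
  by apply: wp_skip; apply: HQ => //; rewrite ?e0 ?d0 //; lia.
apply: wp_seq; apply: wp_sub => /=; rewrite one subn1.
apply: wp_seq; apply: wp_pref => //= rho1 k1 s1 e1 lk.
apply: wp_seq; apply: wp_if; rewrite e1; case p: (pref_code _ _ _ _) => /=.
  apply: wp_skip; apply: wp_if; use_same s1; have [c0|c0] := eqVneq (rho rScan) 0 => /=.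
    apply: wp_add; apply: HQ; [frame| | |lia] => /=; use_same s1.
      by rewrite e0 d0 p.
    by rewrite e0 d0 c0 zero addn0.
  apply: wp_skip; apply: HQ; [frame| | |lia] => /=; use_same s1.
    by rewrite e0 d0 p.
  by rewrite e0 d0 (negPf c0).
apply: wp_const; apply: wp_if => /=; use_same s1; have [c0|c0] := eqVneq (rho rScan) 0 => /=.
  apply: wp_add; apply: HQ; [frame| | |lia] => /=; use_same s1.
    by rewrite e0 d0 p.
  by rewrite e0 d0 c0 zero addn0.
apply: wp_skip; apply: HQ; [frame| | |lia] => /=; use_same s1.
  by rewrite e0 d0 p.
by rewrite e0 d0 (negPf c0).
Qed.

(** * The transition map on codes *)

Section Transition.
Variables (m w : nat).
Local Notation B := (2 ^ w).

Definition digit s i := s %/ B ^ i %% B.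

Definition encode_digits (f : nat -> nat) := \sum_(i < n.+3) f i * B ^ i.

(** The successor skips address 0, which holds the number of goods. *)
Definition picker (f : nat -> nat) := mu (f 2).+1.

(** The verdict on the candidate is split by agent so that each loop iteration uses one agent's rows
    only. Unanimity means that the candidate is free and beats the best good so far, see
    [acceptableP]. *)
Definition acceptable (f : nat -> nat) j :=
  let pref := pref_code (j * m) (n.+1 + j * m) (f 0) in
  ((f j.+3 != 0) ==> ~~ pref (f j.+3).-1) &&
  ((j == picker f) && (f 1 != 0) ==> pref (f 1).-1).

Definition last_pick (f : nat -> nat) j :=
  if [&& m <= f 0, j == picker f & f 1 != 0] then f 1 else f j.+3.

(** While [f 0 < m] the step inspects good [f 0]; at [f 0 = m] it commits the best good, resets the
    scan and passes the turn on. *)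
Definition next_digit (f : nat -> nat) i :=
  match i with
  | 0 => if f 0 < m then (f 0).+1 else 0
  | 1 => if f 0 < m then
           if all (acceptable f) (iota 0 n) then (f 0).+1 else f 1
         else 0
  | 2 => if f 0 < m then f 2 else if (f 2).+1 < n then (f 2).+1 else 0
  | j.+3 => last_pick f j
  end.

Definition next_code s := encode_digits (next_digit (digit s)).

Definition emit_agent s :=
  if (m <= digit s 0) && (digit s 1 != 0) then (picker (digit s)).+1 else 0.

Definition emit_good s := (digit s 1).-1.

(** [8 * w] pays for extracting a digit, [4 * (n * w)] for shifting the new digit by [j * w] places,
    and 80 for the remaining instructions. *)
Definition loop_cost := 8 * w + 4 * (n * w) + 80.
Definition transition_cost := n * loop_cost + 36 * w + 120.

(** Digits of an arbitrary code are only known to be below [B], so a load may run past an agent's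
    row and past the input; hence the summand [B]. *)
Hypothesis RD_small : forall a, a < n.+1 + n * m + B -> RD a.

Definition loop_inv s rho0 k0 j rho k :=
  [/\ same_but [:: rX; rC; rY; rD; rRem; rN; rG; rU; rV; rP; rQ; rOk; rE;
                   rAcc; rSh; rJ; rVal; rTie] rho0 rho,
      [/\ rho rRem = s %/ B ^ j.+3,
          rho rAcc = \sum_(i < j) last_pick (digit s) i * B ^ i
        & rho rOk = all (acceptable (digit s)) (iota 0 j)],
      [/\ rho rSh = j * w, rho rJ = j, rho rVal = j * m & rho rTie = n.+1 + j * m]
    & k <= k0 + j * loop_cost].

Lemma digit_lt s i : digit s i < B.
Proof. by rewrite ltn_mod expn_gt0. Qed.

Lemma wp_agent_loop_body s rho0 k0 j rho k :
  [/\ rho0 rZ = 0, rho0 rOne = 1, rho0 rM = m & rho0 rW = w] ->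
  [/\ rho0 rH = digit s 0, rho0 rB = digit s 1, rho0 rA = picker (digit s)
    & rho0 rScan = m - digit s 0] ->
  j < n -> loop_inv s rho0 k0 j rho k ->
  wp agent_loop_body rho mu RD k (loop_inv s rho0 k0 j.+1).
Proof.
move=> [zero one rm rw] [rh rb ra rscan] jn [same [rrem racc rok] [rsh rj rval rtie] kle].
have small x : x < B -> RD (n.+1 + j * m + x).
  by move=> xB; apply: RD_small; nia.
have dS i : (digit s i).-1 < B by apply: leq_ltn_trans (leq_pred _) (digit_lt _ _).
apply: wp_seq; apply: wp_digit; use_same same => // rho1 s1; rewrite rw rrem => d1 r1.
apply: wp_seq; apply: wp_add => /=; use_same s1; use_same same; rewrite zero addn0.
have dE : rho1 rD = digit s j.+3 by rewrite d1.
apply: wp_seq; apply: wp_reject_taken => /=.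
- by use_same s1; use_same same.
- by use_same s1; use_same same; rewrite rtie rh; apply: small; exact: digit_lt.
- by use_same s1; rewrite rtie dE; apply: small.
move=> rho2 k2 s2 /=; use_same s1 => ok2 lk2.
apply: wp_seq; apply: wp_sub; apply: wp_seq; apply: wp_sub; apply: wp_seq; apply: wp_add => /=.
use_same s2; use_same s1; use_same same; rewrite ra rj.
apply: wp_seq; apply: wp_compare_best => /=.
- by use_same s2; use_same s1; use_same same.
- by use_same s2; use_same s1; use_same same.
- by use_same s2; use_same s1; use_same same; rewrite rtie rh; apply: small; exact: digit_lt.
- by use_same s2; use_same s1; use_same same; rewrite rtie rb; apply: small.
move=> rho3 k3 s3 /=; use_same s2; use_same s1.
(* Two opposite truncated differences both vanish exactly when the numbers are equal. *)
have -> : (j - picker (digit s) + (picker (digit s) - j) == 0) = (j == picker (digit s)).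
  by lia.
use_same same; rewrite rh rb rscan rval rtie dE subn_eq0 => ok3 n3 lk3.
apply: wp_seq; apply: wp_add; apply: wp_seq; apply: wp_add => /=.
apply: wp_seq; apply: wp_shl => /= [|rho4 s4 x4].
  by use_same s3; use_same s2; use_same s1; use_same same.
move: x4; use_same s3; use_same s2; use_same s1; use_same same; rewrite zero !addn0 rsh => x4.
do 4 (apply: wp_seq; apply: wp_add); apply: wp_add => /=.
have loop_bound : 4 * (j * w) <= 4 * (n * w) by nia.
have regs r : r \notin [:: rX; rC; rY; rD; rRem; rN; rG; rU; rV; rP; rQ; rOk; rE] ->
    rho4 r = rho r by move: r; frame.
split.
- by frame.
- rewrite -[in iota _ _]addn1 iotaD all_cat /= add0n andbT; split.
  + by use_same s4; use_same s3; use_same s2; rewrite r1 -divnMA -expnSr.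
  + rewrite big_ord_recr /= regs // racc x4 n3 /last_pick [j * w]mulnC expnM.
    by case: (m <= _); rewrite ?andbT ?andbF.
  + use_same s4; rewrite ok3 ok2 dE rok; use_same same.
    rewrite rval rtie rh.
    case: (all _ _); rewrite /acceptable /=; case: (j == _); case: (digit s 1 != 0) => //=;
      case: (digit s j.+3 != 0) => //=; case: (pref_code _ _ _ (digit s 1).-1) => //=;
      by case: (pref_code _ _ _ (digit s j.+3).-1).
- by rewrite /= !regs // rsh rj rval rtie; use_same same; rewrite rw rm one; split; lia.
- move: kle lk2 lk3 loop_bound; rewrite [j.+1 * _]mulSn {2}/loop_cost; lia.
Qed.

Lemma wp_unpack rho k (Q : store -> nat -> Prop) s :
  [/\ rho rZ = 0, rho rOne = 1, rho rM = m & rho rW = w] -> rho rCode = s ->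
  (forall rho',
     same_but [:: rX; rC; rY; rD; rRem; rH; rB; rT; rA; rScan; rU; rJ; rVal;
                  rTie; rOk; rAcc; rSh] rho rho' ->
     [/\ rho' rH = digit s 0, rho' rB = digit s 1, rho' rA = picker (digit s)
       & rho' rScan = m - digit s 0] ->
     rho' rT = digit s 2 ->
     loop_inv s rho' (k + (24 * w + 52)) 0 rho' (k + (24 * w + 52)) ->
     Q rho' (k + (24 * w + 52))) ->
  wp unpack rho mu RD k Q.
Proof.
move=> [zero one rm rw] rs HQ.
apply: wp_seq; apply: wp_add => /=; rewrite zero addn0 rs.
apply: wp_seq; apply: wp_digit => //= rho1 s1; rewrite rw => d1 r1.
apply: wp_seq; apply: wp_add => /=; use_same s1; rewrite d1 zero addn0.
apply: wp_seq; apply: wp_digit => /=; use_same s1 => // rho2 s2; rewrite rw r1 => d2 r2.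
apply: wp_seq; apply: wp_add => /=; use_same s2; use_same s1; rewrite d2 zero addn0.
apply: wp_seq; apply: wp_digit => /=; use_same s2; use_same s1 => // rho3 s3; rewrite rw r2 => d3 r3.
apply: wp_seq; apply: wp_add => /=; use_same s3; use_same s2; use_same s1; rewrite d3 zero addn0.
have e1 : s %/ B %/ B = s %/ B ^ 2 by rewrite -divnMA mulnn.
have e3 : s %/ B %/ B %/ B = s %/ B ^ 3 by rewrite e1 -divnMA -expnSr.
have dig0 : s %% B = digit s 0 by rewrite /digit divn1.
have dig1 : (s %/ B) %% B = digit s 1 by [].
have dig2 : (s %/ B %/ B) %% B = digit s 2 by rewrite e1.
apply: wp_seq; apply: wp_add => /=; use_same s3; use_same s2; use_same s1.
rewrite one dig2 [_ s 2 + 1]addn1.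
apply: wp_seq; apply: wp_load => /=.
  by apply: RD_small; have := digit_lt s 2; lia.
apply: wp_seq; apply: wp_sub => /=; use_same s3; use_same s2; use_same s1.
rewrite rm dig0.
do 2 (apply: wp_seq; apply: wp_add => /=); use_same s3; use_same s2; use_same s1.
apply: wp_seq; apply: wp_const => /=.
do 2 (apply: wp_seq; apply: wp_add => /=); apply: wp_add => /=.
use_same s3; use_same s2; use_same s1; rewrite zero one /= !addn0.
set k' := _ + 1; have -> : k' = k + (24 * w + 52) by rewrite /k'; lia.
apply: HQ => //=; first by frame.
  by use_same s3; use_same s2; rewrite dig0 dig1.
split=> //=; rewrite ?addn0 //.
by use_same s3; rewrite r3 e3 big_ord0.
Qed.

Lemma encode_digitsE f :
  encode_digits f =
    (((\sum_(i < n) f i.+3 * B ^ i) * B + f 2) * B + f 1) * B + f 0.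
Proof.
rewrite /encode_digits sum_digits_recl (sum_digits_recl _ (f \o succn)).
by rewrite (sum_digits_recl _ (f \o succn \o succn)).
Qed.

Lemma wp_repack rho k (Q : store -> nat -> Prop) s :
  [/\ rho rZ = 0, rho rOne = 1, rho rM = m & rho rW = w] ->
  [/\ rho rH = digit s 0, rho rB = digit s 1, rho rA = picker (digit s)
    & rho rScan = m - digit s 0] ->
  rho rT = digit s 2 ->
  rho rOk = all (acceptable (digit s)) (iota 0 n) ->
  rho rAcc = \sum_(i < n) last_pick (digit s) i * B ^ i ->
  (forall rho' k',
     same_but [:: rX; rC; rH; rB; rT; rU; rEA; rEG] rho rho' ->
     rho' rX = next_code s ->
     rho' rEA = emit_agent s ->
     rho' rEG = emit_good s ->
     k' <= k + (12 * w + 40) ->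
     Q rho' k') ->
  wp repack rho mu RD k Q.
Proof.
move=> [zero one rm rw] [rh rb ra rscan] rt rok racc HQ.
apply: wp_seq; apply: wp_sub => /=; rewrite rb one subn1.
(* All branches of [repack] end in the same shifts, so these are treated once, for any state that
   already holds the new digits. *)
have tail rho1 k1 :
    same_but [:: rH; rB; rT; rU; rEA; rEG] rho rho1 ->
    [/\ rho1 rH = next_digit (digit s) 0, rho1 rB = next_digit (digit s) 1,
        rho1 rT = next_digit (digit s) 2 & rho1 rEA = emit_agent s] ->
    rho1 rEG = emit_good s -> k1 <= k + 15 ->
    wp (mov rX rAcc ;; mov rC rW ;; Call pShl ;; Add rX rX rT ;;
        mov rC rW ;; Call pShl ;; Add rX rX rB ;;
        mov rC rW ;; Call pShl ;; Add rX rX rH) rho1 mu RD k1 Q.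
  move=> s1 [h1 b1 t1 ea1] eg1 lk1.
  do 2 (apply: wp_seq; apply: wp_add => /=); use_same s1; rewrite zero !addn0.
  apply: wp_seq; apply: wp_shl => /= [|rho2 s2 x2]; first by use_same s1.
  do 2 (apply: wp_seq; apply: wp_add => /=); use_same s2; use_same s1.
  rewrite zero !addn0.
  apply: wp_seq; apply: wp_shl => /= [|rho3 s3 x3]; first by use_same s2; use_same s1.
  do 2 (apply: wp_seq; apply: wp_add => /=); use_same s3; use_same s2; use_same s1.
  rewrite zero !addn0.
  apply: wp_seq; apply: wp_shl => /= [|rho4 s4 x4].
    by use_same s3; use_same s2; use_same s1.
  apply: wp_add => /=; use_same s4; use_same s3; use_same s2.
  apply: HQ.
  - by frame.
  - by rewrite /= x4 x3 x2 racc /next_code encode_digitsE /= h1 b1 t1 rw.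
  - by rewrite /=; use_same s4; use_same s3; use_same s2.
  - by rewrite /=; use_same s4; use_same s3; use_same s2.
  - by move: lk1; rewrite rw; lia.
apply: wp_seq; apply: wp_if => /=; rewrite rscan subn_eq0 -ltnNge.
case: ltnP => hm.
  apply: wp_seq; apply: wp_add => /=; rewrite rh one addn1.
  apply: wp_seq; apply: wp_if => /=; rewrite rok.
  case ok: (all _ _) => /=; [apply: wp_add | apply: wp_skip]; apply: wp_add => /=.
    apply: tail; [frame| |by []|lia].
    by rewrite /= hm ok /emit_agent leqNgt hm zero addn0.
  apply: tail; [frame| |by []|lia].
  by rewrite /= hm ok /emit_agent leqNgt hm zero.
apply: wp_seq; apply: wp_if => /=; rewrite rb.
have [b0|b0] := eqVneq (digit s 1) 0 => /=; apply: wp_add => /=;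
  do 2 (apply: wp_seq; apply: wp_add => /=); rewrite zero;
  apply: wp_seq; apply: wp_add => /=; apply: wp_seq; apply: wp_const => /=;
  apply: wp_seq; apply: wp_sub => /=; apply: wp_if => /=; rewrite rt one addn1;
  rewrite subn_eq0 -ltnNge; case: ltnP => tn /=;
  first [apply: wp_skip | apply: wp_add]; (apply: tail; [frame| |by []|lia]);
  by rewrite /= ltnNge hm /= ?zero ?ra ?one /emit_agent hm ?b0 /= ?addn1 ?tn ?ltnNge ?tn.
Qed.

Lemma wp_transition rho k (Q : store -> nat -> Prop) :
  [/\ rho rZ = 0, rho rOne = 1, rho rM = m & rho rW = w] ->
  (forall rho' k', rho' rCode = rho rCode -> rho' rS = rho rS ->
     [/\ rho' rX = next_code (rho rCode), rho' rEA = emit_agent (rho rCode)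
       & rho' rEG = emit_good (rho rCode)] ->
     k' <= k + transition_cost ->
     Q rho' k') ->
  wp transition rho mu RD k Q.
Proof.
move=> consts HQ; have [zero one rm rw] := consts.
apply: wp_seq; apply: wp_unpack => // rho1 s1 d1 t1 inv.
have consts1 : [/\ rho1 rZ = 0, rho1 rOne = 1, rho1 rM = m & rho1 rW = w].
  by use_same s1.
apply: wp_seq; apply: (wp_rep (J := loop_inv (rho rCode) rho1 (k + (24 * w + 52)))) => //.
  by move=> j rho2 k2; apply: wp_agent_loop_body.
move=> rho2 k2 [s2 [_ acc2 ok2] _ lk2].
apply: (@wp_repack _ _ _ (rho rCode)) => //; try by use_same s2.
move=> rho3 k3 s3 x3 ea3 eg3 lk3; apply: HQ => //.
- by use_same s3; use_same s2; use_same s1.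
- by use_same s3; use_same s2; use_same s1.
- by move: lk3 lk2; rewrite /transition_cost; lia.
Qed.

End Transition.
End Straight.
End Program.

(** * Filling the tables and walking along the run *)

(** Races are excluded because different codes write to disjoint sets, none of which is read.
    [Post_ext] says that [Post s] depends only on the addresses written for [s], so it survives the
    other branches. *)
Lemma runs_for_all_codes (R : realType) (P : program) (val : nat -> R)
    p leaf rho0 mu (RD : nat -> Prop) (WR : nat -> nat -> Prop)
    (Post : nat -> store -> Prop) cost L :
  nth Skip P p = for_all_codes p leaf ->
  rho0 rOne = 1 ->
  (forall rho, same_but [:: rK; rCode] rho0 rho -> rho rCode < 2 ^ L ->
     runs P val leaf rho mu RD (WR (rho rCode)) cost cost
       (fun _ mu' => Post (rho rCode) mu')) ->
  (forall s s' a, s < 2 ^ L -> s' < 2 ^ L -> WR s a -> WR s' a -> s = s') ->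
  (forall s a, s < 2 ^ L -> WR s a -> ~ RD a) ->
  (forall s mu1 mu2, (forall a, WR s a -> mu2 a = mu1 a) ->
     Post s mu1 -> Post s mu2) ->
  forall K rho, same_but [:: rK; rCode] rho0 rho -> rho rK = K ->
    (rho rCode).+1 * 2 ^ K <= 2 ^ L ->
    let range s := rho rCode * 2 ^ K <= s < (rho rCode).+1 * 2 ^ K in
    runs P val (Call p) rho mu RD (fun a => exists2 s, range s & WR s a)
      (K.+1 * 2 ^ K * (cost + 8)) (cost + 8 * K + 2)
      (fun _ mu' => forall s, range s -> Post s mu').
Proof.
move=> Pp one leafP WRdisj WR_RD Post_ext.
elim=> [|K IH] rho same eK ltL /=.
  apply: (@runs_weaken _ _ _ _ _ _ RD _ (WR (rho rCode)) _ cost.+2 _ cost.+2).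
  - apply: runs_call; rewrite Pp; apply: runs_if; rewrite eK /=.
    by apply: leafP => //; move: ltL; rewrite muln1.
  - by [].
  - by move=> a wa; exists (rho rCode) => //; rewrite !muln1 leqnn ltnSn.
  - lia.
  - lia.
  - by move=> rho' mu' _ post s; rewrite !muln1 ltnS -eqn_leq => /eqP <-.
set c := rho rCode in ltL *.
have eP : 2 ^ K.+1 = 2 ^ K + 2 ^ K by rewrite expnS mul2n addnn.
have P0 : 0 < 2 ^ K by rewrite expn_gt0.
pose rho1 := update (update rho rK K) rCode (c + c).
pose rho2 := update rho1 rCode (c + c + 1).
have same1 : same_but [:: rK; rCode] rho0 rho1 by rewrite /rho1; frame.
have same2 : same_but [:: rK; rCode] rho0 rho2 by rewrite /rho2 /rho1; frame.
have one1 : rho1 rOne = 1 by rewrite /rho1 /= same.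
have lt1 : (rho1 rCode).+1 * 2 ^ K <= 2 ^ L by rewrite /rho1 /=; nia.
have lt2 : (rho2 rCode).+1 * 2 ^ K <= 2 ^ L by rewrite /rho2 /rho1 /=; nia.
have r1 := IH rho1 same1 erefl lt1.
have r2 := IH rho2 same2 erefl lt2.
set W := K.+1 * _ * _ in r1 r2; set D := cost + _ + _ in r1 r2.
pose inR x s := x * 2 ^ K <= s < x.+1 * 2 ^ K.
have inR_lt x s : x.+1 * 2 ^ K <= 2 ^ L -> inR x s -> s < 2 ^ L.
  by move=> xL /andP[_ lt]; exact: leq_trans xL.
have inR_disj s : inR (c + c) s -> ~~ inR (c + c + 1) s by rewrite /inR; nia.
have range_split s : c * 2 ^ K.+1 <= s < c.+1 * 2 ^ K.+1 <-> inR (c + c) s \/ inR (c + c + 1) s.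
  split; first by case: (ltnP s ((c + c).+1 * 2 ^ K)); rewrite /inR; [left|right]; nia.
  by rewrite /inR; case; nia.
apply: (@runs_weaken _ _ _ _ _ _ RD _
   (fun a => (exists2 s, inR (c + c) s & WR s a) \/ (exists2 s, inR (c + c + 1) s & WR s a))
   _ (2 + (W + (1 + W)).+1).+2 _ (2 + (maxn D (1 + D)).+1).+2 _
   (fun _ mu' => (forall s, inR (c + c) s -> Post s mu') /\
                 (forall s, inR (c + c + 1) s -> Post s mu'))).
- apply: runs_call; rewrite Pp; apply: runs_if; rewrite eK /=.
  apply: (@runs_seq _ _ _ _ _ _ _ _ _ 1 1 (1 + (W + (1 + W)).+1) (1 + (maxn D (1 + D)).+1)).
  apply: runs_wp; apply: wp_sub; split=> //.
  apply: runs_wp_seq; apply: wp_add; split=> //=.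
  rewrite eK same // one subn1 /= -/c -/rho1.
  have r2' : runs P val (Seq (Add rCode rCode rOne) (Call p)) rho1 mu RD
      (fun a => exists2 s, inR (c + c + 1) s & WR s a) (1 + W) (1 + D)
      (fun _ mu' => forall s, inR (c + c + 1) s -> Post s mu').
    by apply: runs_wp_seq; apply: wp_add; rewrite one1; split.
  apply: (runs_weaken (runs_fork r1 r2' _ _)) => //.
  + move=> a [s sR wa]; split; first exact: WR_RD (inR_lt _ _ lt1 sR) wa.
    move=> [s' sR' wa']; move: (inR_disj _ sR).
    by rewrite (WRdisj _ _ _ (inR_lt _ _ lt1 sR) (inR_lt _ _ lt2 sR') wa wa') sR'.
  + by move=> a [s sR wa]; exact: WR_RD (inR_lt _ _ lt2 sR) wa.
  + by move=> a [].
  + move=> rho' mu' _ [_ [_ [mu1 [_ [mu2 [p1 p2 e1 e2]]]]]]; split=> s sR.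
      apply: Post_ext (p1 s sR) => a wa; apply: e1 => -[s' sR' wa'].
      move: (inR_disj _ sR).
      by rewrite (WRdisj _ _ _ (inR_lt _ _ lt1 sR) (inR_lt _ _ lt2 sR') wa wa') sR'.
    apply: Post_ext (p2 s sR) => a wa; apply: e2 => -[s' sR' wa'].
    move: (inR_disj _ sR').
    by rewrite -(WRdisj _ _ _ (inR_lt _ _ lt2 sR) (inR_lt _ _ lt1 sR') wa wa') sR.
- by [].
- by move=> a [] [s sR wa]; exists s => //; apply/range_split; [left|right].
(* The work doubles at each level, plus a constant; raising the factor [K.+1] by one absorbs that
   constant. *)
- by rewrite /W eP; nia.
- by rewrite /D; lia.
- by move=> rho' mu' _ [p1 p2] s /range_split[/p1|/p2].
Qed.

Section Phases.
Variables (n : nat) (R : realType) (val : nat -> R) (m w : nat).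
Local Notation P := (rr_program n).
Local Notation L := (n.+3 * w).
Local Notation S := (2 ^ L).

Definition machine_constants (rho : store) :=
  [/\ rho rZ = 0, rho rOne = 1, rho rM = m & rho rW = w] /\
  (rho rL = L /\ rho rS = S).

Lemma runs_first_table rho mu :
  machine_constants rho -> n.+1 + n * m + 2 ^ w <= S ->
  rho rK = L -> rho rCode = 0 ->
  runs P val (Call pFirst) rho mu (fun a => a < S) (fun a => S <= a < 4 * S)
    (L.+1 * S * (transition_cost n w + 14)) (transition_cost n w + 8 * L + 8)
    (fun _ mu' => forall s, s < S ->
       [/\ mu' (S + s) = emit_agent mu m w s, mu' (2 * S + s) = emit_good w s
         & mu' (3 * S + s) = next_code n val mu m w s]).
Proof.
move=> [consts [rl rs]] nS eK e0; have [zero one rm rw] := consts.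
pose WR s a := [|| a == S + s, a == 2 * S + s | a == 3 * S + s].
pose Post s (mu' : store) := [/\ mu' (S + s) = emit_agent mu m w s,
   mu' (2 * S + s) = emit_good w s & mu' (3 * S + s) = next_code n val mu m w s].
apply: (@runs_weaken _ _ _ _ _ _ (fun a => a < S) _
   (fun a => exists2 s, rho rCode * 2 ^ L <= s < (rho rCode).+1 * 2 ^ L & WR s a)
   _ (L.+1 * S * (transition_cost n w + 6 + 8)) _ (transition_cost n w + 6 + 8 * L + 2) _
   (fun _ mu' => forall s, rho rCode * 2 ^ L <= s < (rho rCode).+1 * 2 ^ L -> Post s mu')).
- apply: (runs_for_all_codes (leaf := first_leaf n) (rho0 := rho)
     (WR := WR) (Post := Post) (L := L)) => //.
  + move=> rho1 s1 lt1.
    have -> : transition_cost n w + 6 = transition_cost n w + (1 + (1 + (1 + (1 + (1 + 1))))) by [].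
    apply: runs_wp_seq; apply: (wp_transition (m := m) (w := w)).
    * by move=> a lt; exact: leq_trans nS.
    * by use_same s1.
    move=> rho2 k2 c2 S2 [x2 ea2 eg2] lk2; split=> //.
    apply: runs_wp_seq; apply: wp_add; split=> //=; rewrite c2 S2 (s1 rS isT) rs.
    apply: (runs_seq (w1 := 1) (d1 := 1)); apply: runs_store => /=.
      by rewrite /WR addnC eqxx.
    apply: runs_wp_seq; apply: wp_add; split=> //=; rewrite S2 (s1 rS isT) rs.
    apply: (runs_seq (w1 := 1) (d1 := 1)); apply: runs_store => /=.
      by rewrite /WR; apply/orP; right; apply/orP; left; apply/eqP; lia.
    apply: runs_wp_seq; apply: wp_add; split=> //=; rewrite S2 (s1 rS isT) rs.
    have P0 : 0 < S by rewrite expn_gt0.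
    apply: runs_store => /=.
      by rewrite /WR; apply/orP; right; apply/orP; right; apply/eqP; lia.
    rewrite ea2 eg2 x2 /Post /update.
    (* The three stores go to different blocks, hence to different addresses. *)
    by split; repeat (case: ifPn => /eqP ?; first [done | exfalso; lia | idtac]).
  + rewrite /WR => s s' a ls ls' wa wa'; move: ls ls'.
    by case/or3P: wa => /eqP; case/or3P: wa' => /eqP; lia.
  + by rewrite /WR => s a ls /or3P[] /eqP -> ; lia.
  + rewrite /WR /Post => s mu1 mu2 e [e1 e2 e3].
    by rewrite !e ?eqxx ?orbT.
  + by rewrite e0 mul1n.
- by [].
- by move=> a [s]; rewrite e0 mul1n /WR => /andP[_ lt] /or3P[] /eqP ->; lia.
- by apply: leq_mul => //; lia.
- by lia.
- by move=> rho' mu' _ H s ls; apply: H; rewrite e0 mul1n.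
Qed.

(** The bound [f s < S] keeps the second lookup inside the source block, away from the block being
    written. *)
Lemma runs_square_table rho mu (f : nat -> nat) :
  machine_constants rho ->
  rho rK = L -> rho rCode = 0 ->
  (forall s, s < S -> f s < S /\ mu (rho rBase + s) = f s) ->
  runs P val (Call pSquare) rho mu (fun a => rho rBase <= a < rho rBase + S)
    (fun a => rho rBase + S <= a < rho rBase + S + S)
    (L.+1 * S * 15) (8 * L + 9)
    (fun _ mu' => forall s, s < S -> mu' (rho rBase + S + s) = f (f s)).
Proof.
move=> [consts [rl rs]] eK e0 table; have [zero one rm rw] := consts.
set b := rho rBase in table *.
pose WR s a := a == b + S + s.
pose Post s (mu' : store) := mu' (b + S + s) = f (f s).
apply: (@runs_weaken _ _ _ _ _ _ (fun a => b <= a < b + S) _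
   (fun a => exists2 s, rho rCode * 2 ^ L <= s < (rho rCode).+1 * 2 ^ L & WR s a)
   _ (L.+1 * S * (7 + 8)) _ (7 + 8 * L + 2) _
   (fun _ mu' => forall s, rho rCode * 2 ^ L <= s < (rho rCode).+1 * 2 ^ L -> Post s mu')).
- apply: (runs_for_all_codes (leaf := square_leaf) (rho0 := rho)
     (WR := WR) (Post := Post) (L := L)) => //.
  + move=> rho1 s1 lt1.
    have [f1 t1] := table _ lt1; have [f2 t2] := table _ f1.
    apply: (runs_wp_seq (k1 := 1) (w2 := 6) (d2 := 6)).
    apply: wp_add; split=> //=; use_same s1; rewrite -/b.
    apply: (runs_wp_seq (k1 := 1) (w2 := 5) (d2 := 5)).
    apply: wp_load => /=; first by rewrite leq_addr ltn_add2l.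
    split=> //; rewrite t1.
    apply: (runs_wp_seq (k1 := 1) (w2 := 4) (d2 := 4)).
    apply: wp_add; split=> //=; use_same s1; rewrite -/b.
    apply: (runs_wp_seq (k1 := 1) (w2 := 3) (d2 := 3)).
    apply: wp_load => /=; first by rewrite leq_addr ltn_add2l.
    split=> //; rewrite t2.
    apply: (runs_wp_seq (k1 := 1) (w2 := 2) (d2 := 2)).
    apply: wp_add; split=> //=; use_same s1; rewrite -/b.
    apply: (runs_wp_seq (k1 := 1) (w2 := 1) (d2 := 1)).
    apply: wp_add; split=> //=; use_same s1; rewrite rs addnAC.
    by apply: runs_store; rewrite /= /WR /Post /= ?eqxx.
  + by rewrite /WR => s s' a ls ls' /eqP -> /eqP; lia.
  + by rewrite /WR => s a ls /eqP ->; lia.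
  + by rewrite /WR /Post => s mu1 mu2 e <-; apply: e.
  + by rewrite e0 mul1n.
- by [].
- by move=> a [s]; rewrite e0 mul1n /WR => /andP[_ lt] /eqP ->; lia.
- by [].
- by lia.
- by move=> rho' mu' _ H s ls; apply: H; rewrite e0 mul1n.
Qed.


Lemma runs_isolated c rho mu (RD WR : nat -> Prop) w1 d1
    (Q Q' : store -> store -> Prop) :
  runs P val c rho mu RD WR w1 d1 Q ->
  (forall rho1 mu1 mu', (forall a, ~ WR a -> mu' a = mu a) -> mu' =1 mu1 ->
     Q rho1 mu1 -> Q' rho mu') ->
  runs P val (Fork c Skip) rho mu RD WR w1.+2 d1.+2 Q'.
Proof.
move=> r1 QQ.
have r2 : runs P val Skip rho mu (fun=> False) (fun=> False) 1 1 (fun _ _ => True).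
  by apply: runs_wp; apply: wp_skip.
apply: (runs_weaken (runs_fork r1 r2 _ _)) => //.
- by move=> a _; split.
- by move=> a [].
- by move=> a [].
- by rewrite addn1.
- by rewrite !ltnS geq_max leqnSn.
- move=> rho' mu' frame_mu [-> [rho1 [mu1 [_ [_ [q _ e _]]]]]].
  apply: QQ q => a; last exact: e.
  by move=> nw; apply: frame_mu => -[].
Qed.

Section Tables.
Variable next : nat -> nat.
Hypothesis next_lt : forall s, s < S -> next s < S.

Lemma iter_next_lt i s : s < S -> iter i next s < S.
Proof. by move=> ltS; elim: i => //= i; apply: next_lt. Qed.

Definition tables_upto k (mu : store) :=
  forall i s, i <= k -> s < S -> mu ((3 + i) * S + s) = iter (2 ^ i) next s.

(** Nothing runs in parallel with this loop, so its reads are unrestricted; the bound on its writes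
    is what preserves the blocks below [4 + k]. *)
Lemma runs_double c : forall k rho mu,
  machine_constants rho -> rho rCnt = c -> rho rBase = (3 + k) * S -> c + k = L ->
  tables_upto k mu ->
  runs P val (Call pDouble) rho mu (fun=> True) (fun a => (4 + k) * S <= a)
    (c * (L.+1 * S * 15 + 8) + 3) (c * (8 * L + 17) + 3)
    (fun rho' mu' => [/\ same_but [:: rK; rCode; rBase; rCnt] rho rho',
       rho' rBase = (3 + L) * S & tables_upto L mu']).
Proof.
elim: c => [|c IH] k rho mu consts ec eb ek tab.
  apply: runs_call; apply: runs_if; rewrite ec /=.
  by have kL : k = L := ek; subst k; apply: runs_wp; apply: wp_skip.
have [[zero one rm rw] [rl rs]] := consts.
have -> : c.+1 * (L.+1 * S * 15 + 8) + 3 =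
  (1 + (1 + ((L.+1 * S * 15).+2 + (1 + (1 + (c * (L.+1 * S * 15 + 8) + 3)))))).+2 by lia.
have -> : c.+1 * (8 * L + 17) + 3 =
  (1 + (1 + ((8 * L + 9).+2 + (1 + (1 + (c * (8 * L + 17) + 3)))))).+2 by lia.
apply: runs_call; apply: runs_if; rewrite ec /=.
apply: runs_wp_seq; apply: wp_add; split=> //.
apply: runs_wp_seq; apply: wp_add; split=> //=.
rewrite zero !addn0 rl.
set rho1 := update _ _ _.
have same1 : same_but [:: rK; rCode] rho rho1 by rewrite /rho1; frame.
have consts1 : machine_constants rho1 by rewrite /machine_constants; use_same same1.
pose f s := iter (2 ^ k) next s.
have tab1 s : s < S -> f s < S /\ mu (rho1 rBase + s) = f s.
  by move=> ltS; split; [exact: iter_next_lt | rewrite same1 // eb tab].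
apply: runs_seq.
have fP : 2 ^ k.+1 = 2 ^ k + 2 ^ k by rewrite expnS mul2n addnn.
apply: runs_weaken (runs_isolated (runs_square_table consts1 erefl erefl tab1)
   (Q' := fun rho' mu' => rho' = rho1 /\ tables_upto k.+1 mu') _) _ _ _ _ _ => //.
- move=> _ mu1 mu' fr e1 q; split=> // i s; rewrite leq_eqVlt => /predU1P[->|lt_ik] ltS.
    rewrite e1 fP iterD -[RHS]/(f (f s)) -(q s ltS) same1 // eb; congr mu1; lia.
  rewrite fr; first exact: tab.
  by rewrite same1 // eb => /andP[+ _]; nia.
- by move=> a; rewrite same1 // eb; lia.
move=> _ mu1 _ [-> tab2].
apply: runs_wp_seq; apply: wp_add; split=> //.
apply: runs_wp_seq; apply: wp_sub; split=> //=.
use_same same1; rewrite ec eb rs one subn1 /=.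
set rho2 := update _ _ _.
have same2 : same_but [:: rK; rCode; rBase; rCnt] rho rho2 by rewrite /rho2 /rho1; frame.
have consts2 : machine_constants rho2 by rewrite /machine_constants; use_same same2.
have base2 : rho2 rBase = (3 + k.+1) * S by rewrite /rho2 /=; lia.
apply: (runs_weaken (IH k.+1 rho2 mu1 consts2 erefl base2 _ tab2)) => //.
- by move: ek; rewrite addSnnS.
- by move=> a; apply: leq_trans; lia.
- by move=> rho3 mu3 _ [s3 b3 t3]; split=> //; frame.
Qed.

Section Walk.
Variables (agent good : nat -> nat) (mu : store).
Hypothesis tab : tables_upto L mu.
Hypothesis agentE : forall s, s < S -> mu (S + s) = agent s.
Hypothesis goodE : forall s, s < S -> mu (2 * S + s) = good s.

(** Reads stay at or above [S] and writes below it, so only two writes could collide; the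
    injectivity hypothesis excludes this. *)
Lemma runs_walk K : forall rho,
  machine_constants rho -> rho rK = K -> K <= L -> rho rCode < S ->
  rho rBase = (3 + K) * S ->
  let st i := iter i next (rho rCode) in
  (forall i j, i < 2 ^ K -> j < 2 ^ K -> agent (st i) != 0 -> agent (st j) != 0 ->
     good (st i) = good (st j) -> i = j) ->
  (forall i, i < 2 ^ K -> agent (st i) != 0 -> good (st i) < S) ->
  runs P val (Call pWalk) rho mu (fun a => S <= a)
    (fun a => exists2 i, i < 2 ^ K & agent (st i) != 0 /\ a = good (st i))
    (K.+1 * 2 ^ K * 16) (8 * K + 9)
    (fun _ mu' => forall i, i < 2 ^ K -> agent (st i) != 0 ->
       mu' (good (st i)) = (agent (st i)).-1).
Proof.
elim: K => [|K IH] rho [[zero one rm rw] [rl rs]] eK KL ltS eb st inj good_lt.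
  apply: (@runs_weaken _ _ _ _ _ _ (fun a => S <= a) _
    (fun a => agent (rho rCode) != 0 /\ a = good (rho rCode)) _ 9 _ 9 _
    (fun _ mu' => agent (rho rCode) != 0 ->
       mu' (good (rho rCode)) = (agent (rho rCode)).-1)).
  - apply: runs_call; apply: runs_if; rewrite eK /=.
    apply: (runs_wp_seq (k1 := 1) (w2 := 6) (d2 := 6)).
    apply: wp_add; split=> //=; rewrite rs.
    apply: (runs_wp_seq (k1 := 1) (w2 := 5) (d2 := 5)).
    apply: wp_load => /=; first exact: leq_addl.
    split=> //; rewrite addnC agentE //.
    apply: runs_if => /=; have [a0|a0] := eqVneq (agent (rho rCode)) 0 => /=.
      by apply: runs_wp; apply: wp_skip.
    apply: (runs_wp_seq (k1 := 1) (w2 := 3) (d2 := 3)).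
    apply: wp_add; split=> //=; rewrite rs.
    apply: (runs_wp_seq (k1 := 1) (w2 := 2) (d2 := 2)).
    apply: wp_load => /=; first exact: leq_addl.
    split=> //; have -> : S + rho rCode + S = 2 * S + rho rCode by lia.
    rewrite goodE //.
    apply: (runs_wp_seq (k1 := 1) (w2 := 1) (d2 := 1)).
    apply: wp_sub; split=> //=; rewrite one subn1.
    by apply: runs_store => //= _; rewrite eqxx.
  - by [].
  - by move=> a [a0 ->]; exists 0.
  - by [].
  - by [].
  - by move=> rho' mu' _ H [|//] _; exact: H.
pose rho1 := update (update rho rK K) rBase ((3 + K) * S).
pose c2 := iter (2 ^ K) next (rho rCode).
pose rho2 := update (update rho1 rU ((3 + K) * S + rho rCode)) rCode c2.
have same1 : same_but [:: rK; rBase] rho rho1 by rewrite /rho1; frame.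
have same2 : same_but [:: rK; rBase; rU; rCode] rho rho2 by rewrite /rho2 /rho1; frame.
have consts1 : machine_constants rho1 by rewrite /machine_constants; use_same same1.
have consts2 : machine_constants rho2 by rewrite /machine_constants; use_same same2.
have fP : 2 ^ K.+1 = 2 ^ K + 2 ^ K by rewrite expnS mul2n addnn.
have P0 : 0 < 2 ^ K by rewrite expn_gt0.
(* The right child's step [i] is step [i + 2 ^ K] of the whole stretch, so its hypotheses are
   instances of the given ones. *)
have st2 i : iter i next c2 = st (i + 2 ^ K) by rewrite /st iterD.
have r1 := IH rho1 consts1 erefl (ltnW KL) ltS erefl.
have r2 := IH rho2 consts2 erefl (ltnW KL) (iter_next_lt _ ltS) erefl.
have {}r1 := r1 (fun i j li lj => inj i j ltac:(lia) ltac:(lia))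
                (fun i li => good_lt i ltac:(lia)).
have {}r2 := r2
  (fun i j li lj => ltac:(rewrite /= !st2 => ai aj eg;
      apply: (@addIn (2 ^ K)); apply: inj => //; lia))
  (fun i li => ltac:(rewrite /= !st2 => ai; apply: good_lt => //; lia)).
set W := K.+1 * _ * _ in r1 r2; set D := 8 * K + 9 in r1 r2.
have r1' : runs P val (Call pWalk) rho1 mu (fun a => S <= a)
    (fun a => exists2 i, i < 2 ^ K & agent (st i) != 0 /\ a = good (st i)) W D
    (fun _ mu' => forall i, i < 2 ^ K -> agent (st i) != 0 ->
       mu' (good (st i)) = (agent (st i)).-1) by exact: r1.
have r2' : runs P val (Add rU rBase rCode ;; LoadMem rCode rU ;; Call pWalk) rho1 mu
    (fun a => S <= a)
    (fun a => exists2 i, i < 2 ^ K & agent (st (i + 2 ^ K)) != 0 /\ a = good (st (i + 2 ^ K)))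
    (1 + (1 + W)) (1 + (1 + D))
    (fun _ mu' => forall i, i < 2 ^ K -> agent (st (i + 2 ^ K)) != 0 ->
       mu' (good (st (i + 2 ^ K))) = (agent (st (i + 2 ^ K))).-1).
  apply: runs_wp_seq; apply: wp_add; split=> //=.
  apply: runs_wp_seq; apply: wp_load; rewrite /rho1 /=; first by rewrite mulnDl; lia.
  split=> //; rewrite tab ?(ltnW KL) //.
  apply: (runs_weaken r2) => //.
    by move=> a [i li]; rewrite /= st2; exists i.
  by move=> rho' mu' _ H i li; rewrite -st2; apply: H.
apply: (@runs_weaken _ _ _ _ _ _ (fun a => S <= a) _
   (fun a => (exists2 i, i < 2 ^ K & agent (st i) != 0 /\ a = good (st i)) \/
             (exists2 i, i < 2 ^ K & agent (st (i + 2 ^ K)) != 0 /\ a = good (st (i + 2 ^ K))))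
   _ (1 + (1 + (W + (1 + (1 + W))).+1)).+2 _ (1 + (1 + (maxn D (1 + (1 + D))).+1)).+2 _
   (fun _ mu' => (forall i, i < 2 ^ K -> agent (st i) != 0 ->
       mu' (good (st i)) = (agent (st i)).-1) /\
       (forall i, i < 2 ^ K -> agent (st (i + 2 ^ K)) != 0 ->
       mu' (good (st (i + 2 ^ K))) = (agent (st (i + 2 ^ K))).-1))).
- apply: runs_call; apply: runs_if; rewrite eK /=.
  apply: runs_wp_seq; apply: wp_sub; split=> //.
  apply: runs_wp_seq; apply: wp_sub; split=> //=.
  rewrite eK one subn1 eb rs /=.
  have -> : (3 + K.+1) * S - S = (3 + K) * S by lia.
  rewrite -/rho1; apply: (runs_weaken (runs_fork r1' r2' _ _)) => //.
  + move=> a [i li [ai ->]]; split; first by have := good_lt i ltac:(lia) ai; lia.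
    move=> [j lj [aj]] /inj H; have := H ltac:(lia) ltac:(lia) ai aj; move: li lj; lia.
  + by move=> a [i li [ai ->]]; have := good_lt (i + 2 ^ K) ltac:(lia) ai; lia.
  + by move=> a [].
  + move=> rho' mu' _ [_ [_ [mu1 [_ [mu2 [q1 q2 e1 e2]]]]]]; split=> i li ai.
      rewrite e1 ?q1 // => -[j lj [aj]] /inj H.
      have := H ltac:(lia) ltac:(lia) ai aj; lia.
    rewrite e2 ?q2 // => -[j lj [aj]] /inj H.
    have := H ltac:(lia) ltac:(lia) ai aj; lia.
- by [].
- move=> a [] [i li H]; first by exists i => //; lia.
  by exists (i + 2 ^ K) => //; lia.
- by rewrite /W fP; nia.
- by rewrite /D; lia.
- move=> rho' mu' _ [q1 q2] i li ai; have [lt|ge] := ltnP i (2 ^ K); first exact: q1.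
  by rewrite -(subnK ge); apply: q2; rewrite ?subnK //; lia.
Qed.

End Walk.
End Tables.
End Phases.

(** * Bit lengths and positional notation *)

Definition bit_length y := if y == 0 then 0 else (trunc_log 2 y).+1.

Lemma bit_length_half y : y != 0 -> bit_length y = (bit_length y./2).+1.
Proof.
rewrite /bit_length => y0; rewrite (negPf y0).
have [y1|y1] := leqP y 1; last by rewrite trunc_log2S // ifN //; lia.
by have -> : y = 1 by lia.
Qed.

Lemma bit_length_gt y : y < 2 ^ bit_length y.
Proof.
rewrite /bit_length; case: eqP => [->//|/eqP y0].
by rewrite trunc_log_ltn.
Qed.

Lemma bit_length_le y : y != 0 -> 2 ^ bit_length y <= 2 * y.
Proof.
move=> y0; rewrite /bit_length (negPf y0) expnS leq_mul2l /=.
by apply: trunc_logP => //; lia.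
Qed.

Section Digits.
Variables (n w : nat).
Local Notation B := (2 ^ w).

Lemma sum_digits_lt N (f : nat -> nat) :
  (forall i, i < N -> f i < B) -> \sum_(i < N) f i * B ^ i < B ^ N.
Proof.
elim: N => [|N IH] fB; first by rewrite big_ord0.
rewrite big_ord_recr /= expnS.
have := IH (fun i li => fB i (ltnW li)); have := fB N (ltnSn N).
have := expn_gt0 B N; set b := B; set x := b ^ N; set y := \sum_(_ < _) _.
by nia.
Qed.

Lemma encode_digits_lt f :
  (forall i, i < n.+3 -> f i < B) -> encode_digits n w f < 2 ^ (n.+3 * w).
Proof. by rewrite mulnC expnM; exact: sum_digits_lt. Qed.

Lemma digit_encode f i :
  (forall i, i < n.+3 -> f i < B) -> i < n.+3 ->
  digit w (encode_digits n w f) i = f i.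
Proof.
rewrite /digit /encode_digits; elim: n.+3 i f => // N IH i f fB.
have B0 : 0 < B by rewrite expn_gt0.
rewrite sum_digits_recl; case: i => [|i] iN.
  by rewrite divn1 modnMDl modn_small ?fB.
rewrite expnS divnMA divnMDl // (divn_small (fB 0 _)) // addn0.
by apply: (IH i (fun j => f j.+1)) => // j jN; exact: fB.
Qed.

(** Holds for unreachable configurations too, so the tabulated map never leaves the range of
    codes. *)
Lemma next_digit_lt (R : realType) (val : nat -> R) mu m f i :
  n + m < B -> (forall i, f i < B) -> next_digit n val mu m f i < B.
Proof.
move=> nmB fB; case: i => [|[|[|i]]] /=.
- by case: ifP => ?; lia.
- by case: ifP => ?; [case: ifP => _; [lia|exact: fB] | lia].
- by case: ifP => ?; [exact: fB | case: ifP => ?; lia].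
- by rewrite /last_pick; case: ifP => _; exact: fB.
Qed.

Lemma digit_next_code (R : realType) (val : nat -> R) mu m s i :
  n + m < B -> i < n.+3 ->
  digit w (next_code n val mu m w s) i = next_digit n val mu m (digit w s) i.
Proof.
move=> nmB iN; rewrite /next_code digit_encode // => j _.
by apply: next_digit_lt => // k; exact: digit_lt.
Qed.

Lemma next_code_lt (R : realType) (val : nat -> R) mu m s :
  n + m < B -> next_code n val mu m w s < 2 ^ (n.+3 * w).
Proof.
move=> nmB; apply: encode_digits_lt => j _.
by apply: next_digit_lt => // k; exact: digit_lt.
Qed.

Lemma memory_fits m : 0 < n -> n + m < B -> n.+1 + n * m + B <= 2 ^ (n.+3 * w).
Proof.
move=> n0 nmB; rewrite [n.+3 * w]mulnC expnM.
have B2 : 2 <= B by lia.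
(* As [n >= 1], a code has at least four digits. *)
apply: (@leq_trans (B ^ 4)); last by rewrite leq_exp2l.
rewrite !expnS expn0 muln1; set b := B in nmB B2 *.
have : b * b <= b * (b * b) by nia.
have : 2 * (b * (b * b)) <= b * (b * (b * b)) by nia.
have : n * m <= b * b by apply: leq_mul; lia.
have : 2 * b <= b * b by nia.
by lia.
Qed.

End Digits.

(** * Setup and composition of the phases *)

Section Main.
Variables (n : nat) (R : realType) (val : nat -> R).
Local Notation P := (rr_program n).

Lemma wp_bits rho mu RD k (Q : store -> nat -> Prop) :
  rho rOne = 1 ->
  (forall rho', same_but [:: rY; rW] rho rho' ->
     rho' rW = rho rW + bit_length (rho rY) ->
     Q rho' (k + (4 * bit_length (rho rY) + 3))) ->
  wp P val (Call pBits) rho mu RD k Q.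
Proof.
move=> one; move eY: (rho rY) => y.
elim/ltn_ind: y rho k Q one eY => y IH rho k Q one eY HQ; apply: wp_call => /=; apply: wp_if; rewrite eY /=.
have [y0|y0] := eqVneq y 0 => /=.
  apply: wp_skip; have -> : k + 1 + 1 + 1 = k + (4 * bit_length y + 3) by rewrite y0 /bit_length eqxx; lia.
  by apply: HQ => //; rewrite y0 /bit_length eqxx addn0.
apply: wp_seq; apply: wp_half; apply: wp_seq; apply: wp_add => /=; rewrite eY one.
apply: (IH y./2) => //= [|rho' same e]; first lia.
have -> : k + 1 + 1 + 1 + 1 + (4 * bit_length y./2 + 3) = k + (4 * bit_length y + 3).
  by rewrite (bit_length_half y0); lia.
apply: HQ; first by frame.
by rewrite e (bit_length_half y0); lia.
Qed.

Variable mu : store.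
Local Notation m := (mu 0).
Local Notation w := (bit_length (n + m)).
Local Notation L := (n.+3 * w).
Local Notation S := (2 ^ L).

Definition setup_cost := 4 * w + n + 4 * L + 20.

Lemma wp_setup RD (Q : store -> nat -> Prop) :
  RD 0 ->
  (forall rho k, machine_constants n m w rho -> rho rK = L -> rho rCode = 0 ->
     k <= setup_cost -> Q rho k) ->
  wp P val (setup n) (fun=> 0) mu RD 0 Q.
Proof.
move=> rd0 HQ; rewrite /setup; set loop := iter _ _ _.
apply: wp_seq; apply: wp_const; apply: wp_seq; apply: wp_load => //=.
apply: wp_seq; apply: wp_const; apply: wp_seq; apply: wp_add => /=.
apply: wp_seq; apply: wp_bits => //= rho1 s1; rewrite add0n => w1.
pose k1 := 0 + 1 + 1 + 1 + 1 + (4 * w + 3).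
pose J j (rho : store) k := same_but [:: rL] rho1 rho /\ rho rL = j * w /\ k = k1 + j.
apply: wp_seq; apply: (wp_rep (J := J)).
- by split=> //; rewrite s1 //= addn0.
- move=> j rho2 k2 jn [s2 [l2 ->]]; apply: wp_add; rewrite l2 s2 // w1.
  by split; [frame | rewrite /= mulSn addnC; split=> //; lia].
move=> rho2 k2 [s2 [l2 ek2]].
apply: wp_seq; apply: wp_const; apply: wp_seq; apply: wp_add => /=.
rewrite l2 s2 // s1 //= addn0.
apply: wp_seq; apply: wp_shl => /= [|rho3 s3 x3]; first by rewrite s2 // s1.
apply: wp_seq; apply: wp_add; apply: wp_add => /=; use_same s3; use_same s2; use_same s1.
rewrite l2 x3 !addn0 mul1n.
apply: HQ => //=; try by use_same s3; use_same s2; use_same s1.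
  rewrite /machine_constants /=; use_same s3; use_same s2; use_same s1.
  by rewrite l2 w1.
by rewrite ek2 /k1 /setup_cost; lia.
Qed.

(** The nesting mirrors [main_body], so that the sequencing rules apply as they stand. *)
Definition main_work :=
  (setup_cost + ((L.+1 * S * (transition_cost n w + 14)).+2 +
    (3 + (L * (L.+1 * S * 15 + 8) + 3 + (2 + L.+1 * S * 16))))).+1.

Definition main_depth :=
  (setup_cost + ((transition_cost n w + 8 * L + 8).+2 +
    (3 + (L * (8 * L + 17) + 3 + (2 + (8 * L + 9)))))).+1.

Lemma runs_main :
  0 < n ->
  let st i := iter i (next_code n val mu m w) 0 in
  let agent := emit_agent mu m w in
  let good := emit_good w in
  (forall i j, i < S -> j < S -> agent (st i) != 0 -> agent (st j) != 0 ->
     good (st i) = good (st j) -> i = j) ->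
  runs P val (Call 0) (fun=> 0) mu (fun=> True) (fun=> True) main_work main_depth
    (fun _ mu' => forall i, i < S -> agent (st i) != 0 ->
       mu' (good (st i)) = (agent (st i)).-1).
Proof.
move=> n0 st agent good inj.
have nmB : n + m < 2 ^ w by exact: bit_length_gt.
have fits := memory_fits n0 nmB.
have next_lt s : s < S -> next_code n val mu m w s < S by move=> _; exact: next_code_lt.
have S0 : 0 < S by rewrite expn_gt0.
have good_lt s : good s < S.
  apply: leq_trans fits; apply: leq_ltn_trans (leq_pred _) _.
  by have := digit_lt w s 1; lia.
apply: runs_call; apply: runs_wp_seq.
apply: wp_setup => // rho k consts eK e0 lk; split=> //.
apply: runs_seq.
apply: (runs_weaken (runs_isolated (runs_first_table val mu consts fits eK e0)
  (Q' := fun rho' mu' => rho' = rho /\ forall s, s < S ->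
       [/\ mu' (S + s) = agent s, mu' (2 * S + s) = good s
         & mu' (3 * S + s) = next_code n val mu m w s]) _)) => //.
  move=> _ mu1 mu' _ e1 q; split=> // s ltS; rewrite !e1; exact: q.
move=> _ mu1 _ [-> tab1].
have [[zero one rm rw] [rl rs]] := consts.
apply: runs_wp_seq; apply: wp_seq; apply: wp_add; apply: wp_seq; apply: wp_add; apply: wp_add => /=.
split=> //; rewrite rl rs zero addn0.
set rho1 := update _ _ _.
have same1 : same_but [:: rBase; rCnt] rho rho1 by rewrite /rho1; frame.
have consts1 : machine_constants n m w rho1 by rewrite /machine_constants; use_same same1.
have base1 : rho1 rBase = (3 + 0) * S by rewrite /rho1 /=; lia.
have tab0 : tables_upto n w (next_code n val mu m w) 0 mu1.
  by move=> i s; rewrite leqn0 => /eqP -> ltS; rewrite addn0; have [_ _] := tab1 s ltS.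
apply: runs_seq.
apply: (runs_weaken (runs_double val next_lt consts1 erefl base1 (addn0 _) tab0)) => //.
move=> rho2 mu2 fr2 [s2 b2 tab2].
(* Doubling writes only from block 4 on, so blocks 1 and 2 are intact. *)
have tabs s : s < S -> mu2 (S + s) = agent s /\ mu2 (2 * S + s) = good s.
  move=> ltS; have [ea eg _] := tab1 s ltS.
  by rewrite !fr2 ?ea ?eg //; rewrite addn0; move: ltS; lia.
apply: runs_wp_seq; apply: wp_seq; apply: wp_add; apply: wp_add => /=; split=> //.
use_same s2; use_same same1; rewrite rl zero !addn0.
set rho3 := update _ _ _.
have same3 : same_but [:: rK; rCode; rBase; rCnt] rho rho3 by rewrite /rho3 /rho1; frame.
have consts3 : machine_constants n m w rho3 by rewrite /machine_constants; use_same same3.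
apply: (runs_weaken (runs_walk (agent := agent) (good := good) val next_lt tab2
  (fun s ltS => proj1 (tabs s ltS)) (fun s ltS => proj2 (tabs s ltS))
  consts3 erefl (leqnn _) _ _ inj _)) => //.
Qed.

End Main.

(** * Round Robin *)

Section RoundRobin.
Variables (R : realType) (n : nat) (I : instance R n).
Local Notation m := (goods I).
Implicit Types (A : assignment I) (i j : 'I_n) (g h : 'I_m).

Definition taken A : {set 'I_m} := \bigcup_j A j.

Lemma mem_taken A h : reflect (exists j, h \in A j) (h \in taken A).
Proof.
by apply: (iffP bigcupP) => [[j _ hj]|[j hj]]; exists j.
Qed.

Definition give A i g : assignment I := [ffun j => if j == i then g |: A j else A j].

Lemma taken_give A i g : taken (give A i g) = g |: taken A.
Proof.
apply/setP => h; rewrite !inE; apply/mem_taken/orP => [[j]|].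
  rewrite ffunE; case: eqP => _; last by right; apply/mem_taken; exists j.
  by rewrite !inE => /orP[->|hj]; [left | right; apply/mem_taken; exists j].
case=> [/eqP ->|/mem_taken[j hj]].
  by exists i; rewrite ffunE eqxx setU11.
by exists j; rewrite ffunE; case: ifP => _ //; rewrite inE hj orbT.
Qed.

Lemma take_bestP A i :
  (taken A = [set: 'I_m] /\ take_best A i = A) \/
  exists g, [/\ g \notin taken A, forall h, h \notin taken A -> prefers i g h
              & take_best A i = give A i g].
Proof.
rewrite /take_best -/(taken A).
have memE h : (h \in [seq g <- pref_list I i | g \notin taken A]) = (h \notin taken A).
  by rewrite mem_filter (perm_mem (pref_list_perm I i)) mem_enum andbT.
have srt : sorted (@prefers _ _ I i) [seq g <- pref_list I i | g \notin taken A].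
  apply: sorted_filter; first exact: prefers_trans.
  exact/sort_sorted/prefers_total.
case: [seq _ <- _ | _] memE srt => [|g s] memE srt.
  left; split=> //; apply/setP => h; rewrite inE.
  by have := memE h; rewrite in_nil => /esym/negbFE.
right; exists g; split=> //; first by rewrite -memE mem_head.
move=> h; rewrite -memE inE => /predU1P[->|hs].
  by have := prefers_total i g g; rewrite orbb.
by have /allP := order_path_min (@prefers_trans _ _ I i) srt; apply.
Qed.

Section Order.
Variables (n_gt0 : 0 < n) (sigma : {perm 'I_n}).

Definition turn p : 'I_n := sigma (Ordinal (ltn_pmod p n_gt0)).

(** The run cut into single picks instead of rounds, the unit that the scan simulates. *)
Fixpoint picks p : assignment I :=
  if p is q.+1 then take_best (picks q) (turn q) else [ffun=> set0].

Lemma picks_rounds r : picks (r * n) = iter r (rr_round sigma) [ffun=> set0].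
Proof.
elim: r => //= r <-; rewrite mulSn addnC /rr_round.
suff H k : k <= n ->
    picks (r * n + k) = foldl (@take_best _ _ I) (picks (r * n)) (take k [seq sigma x | x <- enum 'I_n]).
  by rewrite H // take_oversize // size_map size_enum_ord.
elim: k => [|k IH] kn; first by rewrite addn0 take0.
rewrite addnS [LHS]/= IH; last exact: ltnW.
rewrite (take_nth (turn 0)); last by rewrite size_map size_enum_ord.
rewrite foldl_rcons.
congr take_best; rewrite (nth_map (Ordinal n_gt0)) ?size_enum_ord // /turn.
by congr (sigma _); apply: val_inj; rewrite /= nth_enum_ord // modnMDl modn_small.
Qed.

Lemma round_robinE : round_robin I sigma = picks (m * n).
Proof. by rewrite picks_rounds. Qed.

Lemma picks_leq p q i : p <= q -> picks p i \subset picks q i.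
Proof.
move/subnKC <-; elim: (q - p) => [|d IH]; first by rewrite addn0.
rewrite addnS /=; apply: subset_trans IH _.
have [[_ ->]//|[g [_ _ ->]]] := take_bestP (picks (p + d)) (turn (p + d)).
by rewrite ffunE; case: ifP => // _; apply: subsetUr.
Qed.

Lemma taken_leq p q : p <= q -> taken (picks p) \subset taken (picks q).
Proof.
move=> pq; apply/subsetP => h /mem_taken[j hj]; apply/mem_taken; exists j.
exact: subsetP (picks_leq j pq) _ hj.
Qed.

(** Every pick takes a new good until none is left, so [m] picks exhaust the goods. *)
Lemma card_taken p : minn p m <= #|taken (picks p)|.
Proof.
elim: p => [|p IH]; first by rewrite min0n.
have [[eT _]|[g [ng _ e]]] := take_bestP (picks p) (turn p).
  have /subsetP sub := taken_leq (leqnSn p).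
  suff -> : taken (picks p.+1) = [set: 'I_m] by rewrite cardsT card_ord geq_minr.
  by apply/setP => h; rewrite inE sub // eT inE.
rewrite /= e taken_give cardsU1 ng add1n; apply: leq_trans (_ : (minn p m).+1 <= _); last exact: IH.
by rewrite -minnSS leq_min geq_minl (leq_trans (geq_minr _ _)).
Qed.

Lemma picks_all p : m <= p -> taken (picks p) = [set: 'I_m].
Proof.
move=> mp; apply/eqP; rewrite eqEcard subsetT cardsT card_ord.
by have := card_taken p; rewrite (minn_idPr mp).
Qed.

Lemma picks_disjoint p i j : i != j -> [disjoint picks p i & picks p j].
Proof.
move=> ij; elim: p => [|p IH]; first by rewrite !ffunE -setI_eq0 setI0.
have [[_ e]|[g [ng _ e]]] := take_bestP (picks p) (turn p); first by rewrite /= e.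
have ngk k : g \notin picks p k by apply: contra ng => gk; apply/mem_taken; exists k.
rewrite /= e !ffunE; case: eqP => ei; case: eqP => ej //.
- by rewrite ei ej eqxx in ij.
- by rewrite -setI_eq0 setIUl setU_eq0 !setI_eq0 disjoints1 ngk.
- by rewrite -setI_eq0 setIUr setU_eq0 !setI_eq0 disjoint_sym disjoints1 ngk.
Qed.

Lemma round_robin_allocation : is_allocation (round_robin I sigma).
Proof.
rewrite round_robinE; split=> [i j|]; first exact: picks_disjoint.
by apply: picks_all; nia.
Qed.

Lemma mem_picks p i g :
  g \in picks p i ->
  exists2 q, q < p &
    [/\ turn q = i, g \notin taken (picks q) & g \in taken (picks q.+1)].
Proof.
elim: p => [|p IH]; first by rewrite ffunE inE.
have [gp _|gp] := boolP (g \in picks p i).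
  by have [q qp H] := IH gp; exists q => //; exact: ltnW.
have [[_ e]|[h [nh _ e]]] := take_bestP (picks p) (turn p).
  by rewrite /= e (negPf gp).
move=> gi; have := gi; rewrite /= e ffunE; case: eqP => [ei|_]; last by rewrite (negPf gp).
rewrite !inE (negPf gp) orbF => /eqP eg; exists p => //; rewrite eg; split=> //.
by rewrite /= e taken_give setU11.
Qed.

End Order.

(** * Envy-freeness up to one good *)

Local Open Scope ring_scope.

Lemma bundle_valueU1 i g (X : {set 'I_m}) :
  g \notin X -> bundle_value i (g |: X) = value I i g + bundle_value i X.
Proof. by move=> gX; rewrite /bundle_value big_setU1. Qed.

Lemma bundle_value_ge0 i (X : {set 'I_m}) : 0 <= bundle_value i X.
Proof. by apply: sumr_ge0 => g _; exact: value_ge0. Qed.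

(* The slack [c] is what remains of the value of the good that [i] took last:
   it pays for the next pick of [j], whether that comes before or after the
   next pick of [i]. *)
Definition EF1_slack A i j c :=
  [/\ 0 <= c, forall h, h \notin taken A -> value I i h <= c
    & A j != set0 ->
      exists2 s, s \in A j & bundle_value i (A j :\ s) + c <= bundle_value i (A i)].

(** Only the states before and after the round appear, so the order of [i] and [j] within the round
    does not matter. *)
Definition round_step A A' k :=
  (A' k = A k /\ taken A' = [set: 'I_m]) \/
  exists g, [/\ g \notin taken A, A' k = g |: A k
              & forall h, h \notin taken A' -> value I k h <= value I k g].

(** Since the list has no repetition, each agent picks at most once. A good free after the round was
    free at every turn in it, so each agent values its pick at least as much. *)
Lemma foldl_take_best A (l : seq 'I_n) :
  uniq l ->
  let A' := foldl (@take_best _ _ I) A l in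
  [/\ taken A \subset taken A', forall k, k \notin l -> A' k = A k
    & forall k, k \in l -> round_step A A' k].
Proof.
elim: l A => [|i l IH] A //= /andP[il ul].
have [sub out into] := IH (take_best A i) ul.
set A' := foldl _ _ _ in sub out into *.
have [[eT e]|[g [ng best e]]] := take_bestP A i.
  rewrite e in sub out into; split=> // [k|k].
    by rewrite inE negb_or => /andP[_ /out].
  rewrite inE => /predU1P[->|/into //]; left; split; first exact: out.
  by apply/setP => h; rewrite inE (subsetP sub) // eT inE.
rewrite e taken_give in sub.
have subA : taken A \subset taken A' by apply: subset_trans sub; apply: subsetUr.
split=> // [k|k].
  rewrite inE negb_or => /andP[ki kl].
  by rewrite out // e ffunE (negPf ki).
rewrite inE => /predU1P[->|kl].
  right; exists g; split=> //; first by rewrite out // e ffunE eqxx.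
  move=> h nh; have /best : h \notin taken A by apply: contra nh; apply: (subsetP subA).
  by case/orP=> [/ltW //|/andP[/eqP -> _]].
have ki : k != i by apply: contraNneq il => <-.
have [[eA' eT]|[g' [ng' eA' best']]] := into k kl.
  by left; rewrite eA' e ffunE (negPf ki).
right; exists g'; split=> //; last by rewrite eA' e ffunE (negPf ki).
by apply: contra ng'; rewrite e taken_give inE => ->; rewrite orbT.
Qed.

Lemma notin_bundle A k g : g \notin taken A -> g \notin A k.
Proof. by apply: contra => gk; apply/mem_taken; exists k. Qed.

Lemma EF1_slack_round A A' i j c :
  round_step A A' i -> round_step A A' j -> taken A \subset taken A' ->
  EF1_slack A i j c -> exists c', EF1_slack A' i j c'.
Proof.
move=> stepi stepj subA [c0 cavail cenvy].
(* The new slack is the value of the pick of [i], or 0 if nothing was left. The old slack bounds the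
   pick of [j], which was free before the round. *)
have [c' [c'0 c'avail eqi]] : exists c', [/\ 0 <= c',
    forall h, h \notin taken A' -> value I i h <= c'
  & bundle_value i (A' i) = c' + bundle_value i (A i)].
  case: stepi => [[-> eT]|[g [ng -> best]]].
    by exists 0; split=> // [h|]; rewrite ?eT ?inE // add0r.
  exists (value I i g); split=> //; first exact: value_ge0.
  by rewrite bundle_valueU1 // notin_bundle.
exists c'; split=> // ne.
case: stepj => [[ej _]|[g [ng ej _]]].
  rewrite ej in ne *; have [s sA le] := cenvy ne; exists s => //.
  rewrite eqi addrC lerD2l; apply: le_trans le; by rewrite lerDl.
have gA := notin_bundle j ng.
(* If this is the first good of [j], it is the one removed; otherwise the removed good stays the
   same. *)
have [A0|A0] := eqVneq (A j) set0.
  exists g; rewrite ej ?setU11 // A0 setU0 setDv eqi /bundle_value big_set0 add0r.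
  by rewrite lerDl bundle_value_ge0.
have [s sA le] := cenvy A0; exists s; first by rewrite ej inE sA orbT.
have gs : g != s by apply: contraNneq gA => ->.
rewrite ej setDUl; have -> : [set g] :\ s = [set g].
  by apply/setP => x; rewrite !inE; case: eqP => // ->; case: eqP => // e; rewrite e eqxx in gs.
rewrite bundle_valueU1; last by rewrite inE negb_and gA orbT.
rewrite eqi addrC lerD2l; apply: le_trans le.
by rewrite addrC lerD2l; apply: cavail.
Qed.

Lemma round_robin_EF1 (sigma : {perm 'I_n}) : EF1 (round_robin I sigma).
Proof.
move=> i j ne.
suff [c [c0 _ H]] : exists c, EF1_slack (round_robin I sigma) i j c.
  have [s sA le] := H ne; exists s => //; apply: le_trans le; by rewrite lerDl.
rewrite /round_robin {ne}; elim: (X in iter X) => [|r [c IH]] /=.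
  (* Initially any bound on all values serves as slack, because the empty bundles make the envy
     clause vacuous. *)
  exists (\sum_h value I i h); split=> [|h _|]; last by rewrite ffunE eqxx.
    by apply: sumr_ge0 => h _; exact: value_ge0.
  by rewrite (bigD1 h) //= lerDl; apply: sumr_ge0 => k _; exact: value_ge0.
set A := iter r _ _ in IH *.
have ul : uniq [seq sigma k | k <- enum 'I_n].
  by rewrite map_inj_uniq ?enum_uniq //; exact: perm_inj.
have inl k : k \in [seq sigma k | k <- enum 'I_n].
  by apply/mapP; exists ((sigma^-1)%g k); rewrite ?mem_enum // permKV.
have [sub _ steps] := foldl_take_best A ul.
exact: EF1_slack_round (steps i (inl i)) (steps j (inl j)) sub IH.
Qed.

End RoundRobin.

(** * The scan simulates Round Robin *)

Lemma nth_allpairs (X Y Z : Type) (f : X -> Y -> Z) x0 y0 z0 s t i j :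
  i < size s -> j < size t ->
  nth z0 [seq f x y | x <- s, y <- t] (i * size t + j) = f (nth x0 s i) (nth y0 t j).
Proof.
move=> + jt; elim: s i => // x s IH [|i] /= lti; rewrite nth_cat size_map.
  by rewrite add0n jt (nth_map y0).
by rewrite mulSn -addnA ltnNge leq_addr /= addKn IH.
Qed.

Lemma nth_allpairs_ord (Z : Type) a b (f : 'I_a -> 'I_b -> Z) z0 (i : 'I_a) (j : 'I_b) :
  nth z0 [seq f x y | x <- enum 'I_a, y <- enum 'I_b] (i * b + j) = f i j.
Proof.
rewrite -[X in nth _ _ (_ * X + _)]size_enum_ord (nth_allpairs _ i j) ?size_enum_ord //.
by rewrite !nth_ord_enum.
Qed.

Arguments picks : simpl never.

Section Simulation.
Variables (R : realType) (n : nat) (I : instance R n) (sigma : {perm 'I_n}).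
Hypothesis n_gt0 : 0 < n.
Local Notation m := (goods I).
Local Notation x := (encode_instance I sigma).
Local Notation val := (nth 0%R (in_vals x)).
Local Notation mu := (nth 0 (in_words x)).
Local Notation w := (bit_length (n + m)).
Local Notation next := (next_code n val mu m w).
Local Notation turn := (turn n_gt0 sigma).
Local Notation picks := (picks I n_gt0 sigma).

Lemma picker_turn f p : f 2 = p %% n -> picker mu f = turn p.
Proof.
move=> f2; have lt := ltn_pmod p n_gt0.
rewrite /picker f2 /= nth_cat size_map size_enum_ord lt.
rewrite (nth_map (Ordinal lt)) ?size_enum_ord // /turn.
by congr (nat_of_ord (sigma _)); apply: val_inj; rewrite /= nth_enum_ord.
Qed.

Lemma pref_codeE (j : 'I_n) (h g : 'I_m) :
  pref_code val mu (j * m) (n.+1 + j * m) h g = prefers j h g.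
Proof.
have valE (k : 'I_m) : val (j * m + k) = value I j k by exact: nth_allpairs_ord.
have muE (k : 'I_m) : mu (n.+1 + j * m + k) = tie I j k.
  rewrite -addnA addSn /= nth_cat size_map size_enum_ord ltnNge leq_addr /= addKn.
  exact: nth_allpairs_ord.
rewrite /pref_code !valE !muE /prefers.
by case: (ltgtP (value I j g)).
Qed.

(* The scan for pick number [p] has inspected the goods below [y]. *)
Definition simulates p y (f : nat -> nat) :=
  [/\ f 0 = y, f 2 = p %% n, forall j : 'I_n, f j.+3 <= m,
      forall h, h \in taken (picks p) <->
        exists (j : 'I_n) (g : 'I_m), f j.+3 = g.+1 /\ prefers j h g
    & (f 1 = 0 /\ forall h : 'I_m, h < y -> h \in taken (picks p)) \/
      exists g : 'I_m, [/\ f 1 = g.+1, g \notin taken (picks p)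
        & forall h : 'I_m, h < y -> h \notin taken (picks p) -> prefers (turn p) g h]].

Lemma nat_ordP k : k <= m -> k = 0 \/ exists g : 'I_m, k = g.+1.
Proof.
by case: k => [|k] km; [left | right; exists (Ordinal km)].
Qed.

(** Free means rejected by no agent's last pick. The comparison with the best good is demanded of
    the picker alone, so the conjunction over all agents contains it once. *)
Lemma acceptableP p (h : 'I_m) f :
  simulates p h f ->
  all (acceptable n val mu m f) (iota 0 n) =
    (h \notin taken (picks p)) &&
    ((f 1 != 0) ==> [exists g : 'I_m, (f 1 == g.+1) && prefers (turn p) h g]).
Proof.
move=> [f0 f2 fm takenE best].
have bestm : (f 1 != 0) -> exists g : 'I_m, f 1 = g.+1.
  by case: best => [[-> //]|[g [e _ _]] _]; exists g.
apply/allP/andP => [acc|[nt imp] j].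
  split.
    apply/negP => /takenE[j [g [e pr]]].
    have := acc j; rewrite mem_iota ltn_ord => /(_ isT) /andP[].
    by rewrite e f0 /= pref_codeE pr.
  apply/implyP => f1; have [g e] := bestm f1; apply/existsP; exists g; rewrite e eqxx /=.
  have := acc (turn p); rewrite mem_iota ltn_ord => /(_ isT) /andP[_].
  by rewrite (picker_turn f2) eqxx e f0 /= pref_codeE.
rewrite mem_iota add0n /= => jn; pose j' := Ordinal jn.
rewrite /acceptable f0; apply/andP; split.
  apply/implyP; have [-> //|[g e] _] := nat_ordP (fm j').
  rewrite e /= (pref_codeE j'); apply: contra nt => pr; apply/takenE.
  by exists j', g.
apply/implyP => /andP[/eqP ej f1]; move: imp; rewrite f1 => /existsP[g /andP[/eqP -> pr]].
by rewrite /= ej (picker_turn f2) pref_codeE.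
Qed.

(** Packing keeps only the first [n + 3] digits. *)
Lemma simulates_ext p y f f' :
  (forall i, i < n.+3 -> f' i = f i) -> simulates p y f -> simulates p y f'.
Proof.
move=> e [f0 f2 fm takenE best]; split; rewrite ?e //.
- by move=> j; rewrite e ?ltnS.
- move=> h; split=> [/takenE[j [g [ej pr]]]|[j [g [ej pr]]]].
    by exists j, g; rewrite e ?ltnS.
  by apply/takenE; exists j, g; rewrite -e ?ltnS.
Qed.

Lemma simulates_scan p (h : 'I_m) f :
  simulates p h f -> simulates p h.+1 (next_digit n val mu m f).
Proof.
move=> sim; have acc := acceptableP sim; have [f0 f2 fm takenE best] := sim.
have lastE j : last_pick mu m f j = f j.+3.
  by rewrite /last_pick f0 leqNgt ltn_ord.
split; rewrite /= ?f0 ?ltn_ord //.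
- by move=> j; rewrite lastE.
- move=> k; split=> [/takenE[j [g [e pr]]]|[j [g [e pr]]]].
    by exists j, g; rewrite lastE.
  by apply/takenE; exists j, g; rewrite -lastE.
rewrite acc; have [ht|ht] /= := boolP (h \in taken (picks p)).
  case: best => [[-> all_t]|[g [e ng best]]].
    by left; split=> // k; rewrite ltnS leq_eqVlt => /predU1P[/val_inj ->|/all_t].
  right; exists g; split=> // k; rewrite ltnS leq_eqVlt => /predU1P[/val_inj ->|].
    by rewrite ht.
  exact: best.
case: best => [[-> all_t]|[g [e ng best]]] /=.
  right; exists h; split=> // k; rewrite ltnS leq_eqVlt => /predU1P[/val_inj -> _|/all_t -> //].
  by have := prefers_total (turn p) h h; rewrite orbb.
rewrite e /=; case: existsP => [[g' /andP[/eqP[/val_inj eg] pr]]|no].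
  right; exists h; split=> // k; rewrite ltnS leq_eqVlt => /predU1P[/val_inj -> _|kh nk].
    by have := prefers_total (turn p) h h; rewrite orbb.
  by apply: (prefers_trans pr); rewrite -eg; apply: best.
right; exists g; split=> // k; rewrite ltnS leq_eqVlt => /predU1P[/val_inj -> _|]; last exact: best.
have /orP[pr|//] := prefers_total (turn p) h g.
by case: no; exists g; rewrite eqxx.
Qed.

Lemma next_turn p : (if (p %% n).+1 < n then (p %% n).+1 else 0) = p.+1 %% n.
Proof.
have lt := ltn_pmod p n_gt0; have -> : p.+1 %% n = (p %% n).+1 %% n.
  by rewrite -addn1 -modnDml addn1.
case: (ltnP (p %% n).+1 n) => h; first by rewrite [RHS]modn_small.
have -> : (p %% n).+1 = n by apply/eqP; rewrite eqn_leq lt h.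
by rewrite modnn.
Qed.

Lemma simulates_commit p f :
  simulates p m f ->
  simulates p.+1 0 (next_digit n val mu m f) /\
  ((f 1 = 0 /\ picks p.+1 = picks p) \/
   exists g : 'I_m, [/\ f 1 = g.+1, g \notin taken (picks p)
     & picks p.+1 = give (picks p) (turn p) g]).
Proof.
move=> [f0 f2 fm takenE best].
have pickE : (f 1 = 0 /\ picks p.+1 = picks p) \/
   exists g : 'I_m, [/\ f 1 = g.+1, g \notin taken (picks p)
     & picks p.+1 = give (picks p) (turn p) g].
  (* With all goods inspected, the scan's best and the good of [take_best] are both most preferred
     among the free ones, hence equal by antisymmetry. *)
  have [[eT e]|[g [ng bestg e]]] := take_bestP (picks p) (turn p).
    left; split=> //; case: best => [[]//|[g [_]]].
    by rewrite eT inE.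
  right; exists g; case: best => [[_ all_t]|[g' [e1 ng' bestg']]].
    by rewrite all_t in ng.
  suff eg : g = g' by rewrite e1 -eg.
  by apply: (@prefers_anti _ _ I (turn p)); rewrite bestg ?bestg'.
split=> //.
have lastE j : last_pick mu m f j =
    if (j == picker mu f) && (f 1 != 0) then f 1 else f j.+3.
  by rewrite /last_pick f0 leqnn.
split; rewrite /= ?f0 ?ltnn //.
- by rewrite f2 next_turn.
- move=> j; rewrite lastE; case: ifP => // /andP[_ f1].
  by case: pickE => [[e]|[g [-> _ _]]]; [rewrite e in f1 | exact: ltn_ord].
- move=> h; case: pickE => [[f10 ->]|[g [f1 ng ->]]].
    split=> [/takenE[j [g [e pr]]]|[j [g [e pr]]]].
      by exists j, g; rewrite lastE f10 andbF.
    by apply/takenE; exists j, g; move: e; rewrite lastE f10 andbF.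
  rewrite taken_give !inE; have lastE' (j : 'I_n) : last_pick mu m f j =
      if j == turn p then g.+1 else f j.+3.
    by rewrite lastE (picker_turn f2) f1 andbT.
  have bestg k : k \notin taken (picks p) -> prefers (turn p) g k.
    case: best => [[f10]|[g' [f1' _ b]]]; first by rewrite f10 in f1.
    by move: f1'; rewrite f1 => -[/val_inj ->]; apply: b.
  split=> [/predU1P[->|/takenE[j [k [e pr]]]]|[j [k]]].
  + exists (turn p), g; rewrite lastE' eqxx; split=> //.
    by have := prefers_total (turn p) g g; rewrite orbb.
  + case ej: (j == turn p).
      exists (turn p), g; rewrite lastE' eqxx; split=> //.
      rewrite (eqP ej) in e pr; apply: (prefers_trans pr).
      (* The old pick [k] is replaced by [g]. The picker prefers [k] to [g]: otherwise [g] would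
         already count as taken. *)
      have /orP[//|pr'] := prefers_total (turn p) k g.
      by case/negP: ng; apply/takenE; exists (turn p), k.
    by exists j, k; rewrite lastE' ej.
  + rewrite lastE'; case: eqP => [->|_] [e pr].
      case: e => /val_inj e; rewrite -e in pr.
      (* A good liked at least as much as [g] is [g] itself or was taken before, as [g] was the best
         free good. *)
      have [//|hg] := eqVneq h g; rewrite /=; apply/negPn/negP => nh.
      case/eqP: hg; apply: (@prefers_anti _ _ I (turn p)).
      by rewrite pr bestg.
    by apply/orP; right; apply/takenE; exists j, k.
- by left; split.
Qed.

Lemma simulates0 : simulates 0 0 (digit w 0).
Proof.
have d0 i : digit w 0 i = 0 by rewrite /digit div0n mod0n.
split; rewrite ?d0 ?mod0n //.
- by move=> j; rewrite d0.
- move=> h; split=> [/mem_taken[j]|[j [g []]]]; first by rewrite ffunE inE.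
  by rewrite d0.
- by left.
Qed.

Lemma simulates_next p y s :
  simulates p y (next_digit n val mu m (digit w s)) ->
  simulates p y (digit w (next s)).
Proof.
apply: simulates_ext => i lt; apply: digit_next_code => //.
exact: bit_length_gt.
Qed.

Local Notation st i := (iter i next 0).

(** A pick lasts [m + 1] steps: [m] inspections and a commit. [p] is unbounded, so the idle steps
    after the last good are covered. *)
Lemma simulates_run p y : y <= m -> simulates p y (digit w (st (p * m.+1 + y))).
Proof.
have scan q k : simulates q 0 (digit w (st k)) -> forall z, z <= m -> simulates q z (digit w (st (k + z))).
  move=> sim0; elim=> [|z IH] zm; first by rewrite addn0.
  rewrite addnS iterS; apply: simulates_next.
  by apply: (@simulates_scan _ (Ordinal zm)); apply: IH; exact: ltnW.
move=> ym; apply: (scan p _ _ y ym); elim: p {y ym} => [|p IH]; first exact: simulates0.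
rewrite mulSn addSn [m + _]addnC iterS.
apply: simulates_next.
by have [] := simulates_commit (scan _ _ IH m (leqnn m)).
Qed.

Lemma emit_at p y :
  y <= m -> emit_agent mu m w (st (p * m.+1 + y)) != 0 ->
  y = m /\ exists g : 'I_m, [/\ emit_good w (st (p * m.+1 + y)) = g,
    g \notin taken (picks p) & g \in taken (picks p.+1)].
Proof.
move=> ym; have sim := simulates_run p ym; have [f0 _ _ _ _] := sim.
rewrite /emit_agent f0; case: ifP => // /andP[my f1n] _.
have ey : y = m by apply/eqP; rewrite eqn_leq ym.
split=> //; move: sim f1n; rewrite ey => /simulates_commit[_ [[f1 _]|[g [f1 ng e]]]].
  by rewrite f1.
by move=> _; exists g; rewrite /emit_good f1 e taken_give setU11.
Qed.

(** Emission happens only at commits, and the emitted good is free before that pick and taken after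
    it. Taken sets grow, so this happens in one pick only. *)
Lemma emit_inj i j :
  emit_agent mu m w (st i) != 0 -> emit_agent mu m w (st j) != 0 ->
  emit_good w (st i) = emit_good w (st j) -> i = j.
Proof.
have split_time k : k = k %/ m.+1 * m.+1 + k %% m.+1 /\ k %% m.+1 <= m.
  by split; [exact: divn_eq | rewrite -ltnS ltn_pmod].
have [ei li] := split_time i; have [ej lj] := split_time j.
set p := i %/ _ in ei; set q := j %/ _ in ej.
rewrite ei ej => /(emit_at li)[yi [g [-> ng ig]]] /(emit_at lj)[yj [h [-> nh ih]]] /val_inj egh.
rewrite yi yj; suff -> : p = q by [].
subst h; case: (ltngtP p q) => // lt.
- by case/negP: nh; apply: subsetP (taken_leq _ _ _ lt) _ ig.
- by case/negP: ng; apply: subsetP (taken_leq _ _ _ lt) _ ih.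
Qed.

Lemma emitted (g : 'I_m) i :
  g \in round_robin I sigma i ->
  exists2 k, k < 2 ^ (n.+3 * w) &
    emit_agent mu m w (st k) = i.+1 /\ emit_good w (st k) = g.
Proof.
rewrite (round_robinE I n_gt0) => /mem_picks[p pmn [ti ng ig]].
(* This is the time of the commit of pick [p]; as [p < m * n], three digits suffice to bound it. *)
exists (p * m.+1 + m).
  have nmB := bit_length_gt (n + m); rewrite [n.+3 * w]mulnC expnM.
  apply: (@leq_trans ((2 ^ w) ^ 3)); last by rewrite leq_exp2l //; lia.
  rewrite !expnS expn0 muln1; set b := 2 ^ w in nmB *.
  have : p.+1 * m.+1 <= (m * n) * m.+1 by rewrite leq_mul2r pmn orbT.
  have : m * n <= b * b by apply: leq_mul; lia.
  have : m.+1 <= b by lia.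
  nia.
have sim := simulates_run p (leqnn m); have [f0 f2 _ _ _] := sim.
have [_ [[_ e]|[h [f1 nh e]]]] := simulates_commit sim.
  by rewrite e (negPf ng) in ig.
rewrite /emit_agent /emit_good f0 f1 leqnn /= (picker_turn f2) ti; split=> //.
by move: ig; rewrite e taken_give !inE (negPf ng) orbF => /eqP ->.
Qed.

End Simulation.

(** * Resource bounds *)

Section Bounds.
Variables (n : nat) (mu : store).
Hypothesis n_gt0 : 0 < n.
Local Notation w := (bit_length (n + mu 0)).
Local Notation L := (n.+3 * w).
Local Notation S := (2 ^ L).

(** [transition_cost] with each constant term multiplied by [w], which is legitimate as [w >= 1]. *)
Definition transition_factor := n * (4 * n + 88) + 156.

Lemma bit_length_gt0 : 0 < w.
Proof. by rewrite /bit_length; case: eqP => //; lia. Qed.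

Lemma transition_cost_le : transition_cost n w <= transition_factor * w.
Proof.
rewrite /transition_cost /loop_cost /transition_factor; have := bit_length_gt0.
by move: w => v v0; nia.
Qed.

(** The square comes from doubling: [L] squarings of depth linear in [L], where [L] is a multiple of
    [w]. *)
Lemma main_depth_le :
  main_depth n mu <=
    (transition_factor + 8 * n.+3 ^ 2 + 50 * n.+3 + n + 100) * w ^ 2.
Proof.
have := transition_cost_le; have := bit_length_gt0.
rewrite /main_depth /setup_cost; move: w (transition_cost _ _) => v t v0 tv.
move: transition_factor n.+3 tv => T a tv.
have vv : v <= v ^ 2 by rewrite -{1}[v]expn1 leq_pexp2l.
have : T * v <= T * v ^ 2 by rewrite leq_mul2l vv orbT.
have : a * v <= a * v ^ 2 by rewrite leq_mul2l vv orbT.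
have : n <= n * v ^ 2 by rewrite leq_pmulr ?expn_gt0 ?v0.
have -> : a * v * (8 * (a * v) + 17) = 8 * (a ^ 2 * v ^ 2) + 17 * (a * v).
  by rewrite !expnS !expn0; lia.
rewrite !mulnDl -!mulnA; have : 1 <= v ^ 2 by rewrite expn_gt0 v0.
move: (n * v ^ 2) (a * v ^ 2) (T * v ^ 2) (T * v) (a * v) (a ^ 2 * v ^ 2) (v ^ 2) tv vv.
by lia.
Qed.

(** Logarithmic factors are absorbed by [L < S]; the [L] squarings, of work [L.+1 * S] up to
    constants, give the cube. *)
Lemma main_work_le :
  main_work n mu <= (transition_factor + n + 150) * S ^ 3.
Proof.
have := transition_cost_le; have := bit_length_gt0.
rewrite /main_work /setup_cost; move: (transition_cost _ _) => t w0 tw.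
have LS : L < S by rewrite ltn_expl.
have wL : w <= L by rewrite leq_pmull.
move: w L S w0 tw LS wL => v l s v0 tv ls vl.
have ts : t <= transition_factor * s.
  by apply: leq_trans tv _; rewrite leq_mul2l (leq_trans vl (ltnW ls)) orbT.
move: transition_factor ts => T ts.
have s1 : 1 <= s by lia.
have s2 : s <= s ^ 2 by rewrite -{1}[s]expn1 leq_pexp2l.
have s3 : s ^ 2 <= s ^ 3 by rewrite leq_pexp2l.
have sq : l.+1 * s <= s ^ 2 by rewrite expnS expn1 leq_mul2r ls orbT.
have b1 : l.+1 * s * (t + 14) <= T * s ^ 3 + 14 * s ^ 2.
  apply: (@leq_trans (s ^ 2 * (T * s + 14))); first by apply: leq_mul; lia.
  by rewrite !expnS !expn0; lia.
have b2 : l * (l.+1 * s * 15 + 8) <= 15 * s ^ 3 + 8 * s.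
  apply: (@leq_trans (s * (s ^ 2 * 15 + 8))); first by apply: leq_mul; lia.
  by rewrite !expnS !expn0; lia.
have b3 : n <= n * s ^ 3 by rewrite leq_pmulr ?expn_gt0 ?s1.
have -> : (T + n + 150) * s ^ 3 = T * s ^ 3 + n * s ^ 3 + 150 * s ^ 3 by rewrite !mulnDl.
move: (l.+1 * s * (t + 14)) b1 => x b1; move: (l * (l.+1 * s * 15 + 8)) b2 => y b2.
move: (l.+1 * s) sq => z sq; move: (T * s ^ 3) b1 => Ts b1.
move: (n * s ^ 3) b3 => ns b3; move: (s ^ 2) (s ^ 3) s2 s3 b1 b2 sq => p q s2 s3 b1 b2 sq.
by lia.
Qed.

End Bounds.

Theorem theorem2 (R : realType) (n : nat) (n_gt0 : 0 < n) :
  NC_solvable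
    (fun x : instance R n * {perm 'I_n} => encode_instance x.1 x.2)
    (fun x mem => outputs_assignment mem (round_robin x.1 x.2))
  /\ (forall (I : instance R n) (sigma : {perm 'I_n}),
        is_allocation (round_robin I sigma) /\ EF1 (round_robin I sigma)).
Proof.
split; last first.
  by move=> I sigma; split; [exact: round_robin_allocation | exact: round_robin_EF1].
pose cd := transition_factor n + 8 * n.+3 ^ 2 + 50 * n.+3 + n + 100.
(* The power of two comes from [2 ^ w <= 2 * N], raised to the exponent [3 (n + 3)] of [S ^ 3]. *)
pose cw := (transition_factor n + n + 150) * 2 ^ (n.+3 * 3).
exists (rr_program n), (cd + cw), (n.+3 * 3) => -[I sigma] /=.
set N := input_size _; pose mu := nth 0 (in_words (encode_instance I sigma)).
pose val := nth 0%R (in_vals (encode_instance I sigma)).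
have size_words : n + goods I < N.
  rewrite /N /input_size /= size_cat size_map size_enum_ord !size_allpairs !size_enum_ord.
  by have : goods I <= n * goods I; [rewrite leq_pmull | lia].
pose w := bit_length (n + goods I).
have w_log : w <= (trunc_log 2 N).+1.
  by rewrite /w /bit_length; case: eqP => // _; rewrite ltnS leq_trunc_log // ltnW.
have w_size : 2 ^ w <= 2 * N.
  have nm0 : n + goods I != 0 by lia.
  by apply: leq_trans (bit_length_le nm0) _; rewrite leq_mul2l ltnW.
have inj i j (_ : i < 2 ^ (n.+3 * w)) (_ : j < 2 ^ (n.+3 * w)) := @emit_inj _ _ I sigma n_gt0 i j.
have [o [E _ _ out [ow od]]] := @runs_main n R val mu n_gt0 inj.
exists o; split=> //.
- move=> i g.
  (* Every good has an owner, whose number is written at its address; disjointness of the bundles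
     settles all other agents. *)
  have [disj cov] := round_robin_allocation I n_gt0 sigma.
  have : g \in \bigcup_i round_robin I sigma i by rewrite cov inE.
  case/bigcupP=> i0 _ gi0.
  have [k ltk [ea eg]] := emitted n_gt0 gi0.
  have := out k ltk; rewrite ea eg => /(_ isT) ->.
  have [<-|ne] := eqVneq i0 i; first by rewrite gi0 eqxx.
  by rewrite (disjointFr (disj _ _ ne) gi0); apply/esym/negbTE.
- apply: leq_trans ow _; apply: leq_trans (main_work_le mu n_gt0) _.
  apply: (@leq_trans (cw * N ^ (n.+3 * 3))); last by rewrite leq_mul2r leq_addl orbT.
  rewrite /cw -mulnA leq_mul2l -expnMn; apply/orP; right.
  rewrite -[in X in X <= _]expnM mulnAC [_ * w]mulnC expnM.
  by rewrite leq_exp2r.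
- apply: leq_trans od _; apply: leq_trans (main_depth_le mu n_gt0) _.
  apply: (@leq_trans (cd * (trunc_log 2 N).+1 ^ (n.+3 * 3))); last by rewrite leq_mul2r leq_addr orbT.
  rewrite leq_mul2l; apply/orP; right.
  apply: leq_trans (_ : (trunc_log 2 N).+1 ^ 2 <= _); first by rewrite leq_exp2r.
  by rewrite leq_pexp2l //; lia.
Qed.
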